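(* Let $K$ be a field of characteristic $0$, let $A,A'$ be commutative unital $K$-algebras, let $C$ be a cocommutative $K$-coalgebra and let $\Phi:C\to\mathrm{Hom}_K(A,A')$ be a measuring of algebras. For each $x\in C$ and $n\ge0$ the following diagram commutes: $$\begin{array}{ccc}HC_n(A)&\xrightarrow{\bar\pi_n}&\Omega^n_A/d\Omega^{n-1}_A\oplus HDR_A^{n-2}\oplus HDR_A^{n-4}\oplus\cdots\\ {\scriptstyle HC^\Phi_n(x)}\downarrow&&\downarrow\\ HC_n(A')&\xrightarrow{\bar\pi_n}&\Omega^n_{A'}/d\Omega^{n-1}_{A'}\oplus HDR_{A'}^{n-2}\oplus HDR_{A'}^{n-4}\oplus\cdots\end{array}$$ where the right vertical map is $\Omega^n_\Phi/d\Omega^{n-1}_\Phi(x)\oplus HDR^{n-2}_\Phi(x)\oplus HDR_\Phi^{n-4}(x)\oplus\cdots$.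
   Context: Write $\Delta_C(x)=x_{(1)}\otimes x_{(2)}$ (Sweedler, sums suppressed; likewise iterated). A measuring $\Phi:C\to\mathrm{Hom}_K(A,A')$ is a $K$-linear map with $\Phi(x)(ab)=\Phi(x_{(1)})(a)\Phi(x_{(2)})(b)$ and $\Phi(x)(1_A)=\epsilon_C(x)1_{A'}$; write $x(a)=\Phi(x)(a)$. Let $C_n(A)=A^{\otimes n+1}$, with $d_i$ the Hochschild faces, $s_n(a_0,\dots,a_n)=(a_0,\dots,a_n,1)$, $t_n(a_0,\dots,a_n)=(-1)^n(a_n,a_0,\dots,a_{n-1})$, $b=\sum_i(-1)^id_i$ and $B=(-1)^{n+1}(1-t_{n+1})t_{n+1}s_n(1+t_n+\cdots+t_n^n):C_n(A)\to C_{n+1}(A)$. $HC_\bullet(A)$ is the total homology of the mixed complex $(C_\bullet(A),b,B)$, and $HC_\bullet^\Phi(x)$ is induced by $(a_0,\dots,a_n)\mapsto(x_{(1)}(a_0),\dots,x_{(n+1)}(a_n))$. $\Omega_A^p=\wedge^p_A\Omega_A^1$ are the Kähler differential forms of $A$ over $K$ ($\Omega^0_A=A$), $d(a_0da_1\cdots da_p)=da_0da_1\cdots da_p$, and $HDR_A^\bullet$ is the cohomology of $(\Omega_A^\bullet,d)$ (zero in negative degrees). The well-defined maps $\Omega^p_\Phi(x):\Omega^p_A\to\Omega^p_{A'}$, $a_0da_1\cdots da_p\mapsto x_{(1)}(a_0)d(x_{(2)}(a_1))\cdots d(x_{(p+1)}(a_p))$, commute with $d$ and induce $HDR_\Phi^\bullet(x)$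 and the maps $\Omega^n_\Phi/d\Omega^{n-1}_\Phi(x)$. The maps $\pi_n/n!:C_n(A)\to\Omega_A^n$, $a_0\otimes\cdots\otimes a_n\mapsto\frac1{n!}a_0da_1\cdots da_n$, give a morphism of mixed complexes $(C_\bullet(A),b,B)\to(\Omega_A^\bullet,0,d)$, and $\bar\pi_n$ is the induced map on total homology. *)

(* Defs.v *)
From HB Require Import structures.
From mathcomp Require Import all_boot all_order all_algebra.
From mathcomp Require Import boolp finmap monalg.

Set Implicit Arguments.
Unset Strict Implicit.
Unset Printing Implicit Defensive.

Import GRing.Theory.
Import Quotient.
Local Open Scope ring_scope.
Local Open Scope quotient_scope.

(* MathComp only makes {malg R[I]} an R-module for R nontrivial; the scaling is
   redone here because the zero ring is not excluded. *)
Definition freemod (R : pzRingType) (I : choiceType) : Type := {malg R[I]}.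
HB.instance Definition _ (R : pzRingType) (I : choiceType) :=
  GRing.Zmodule.on (freemod R I).

Section Free.
Variables (R : pzRingType) (I : choiceType).

Definition fscale (c : R) (g : freemod R I) : freemod R I :=
  [malg i in msupp g => c * g@_i].

Lemma fscaleE c g i : (fscale c g)@_i = c * g@_i.
Proof.
rewrite /fscale mcoeffE; case: ifPn => // /mcoeff_outdom ->.
by rewrite mulr0.
Qed.

Fact fscaleA c1 c2 g : fscale c1 (fscale c2 g) = fscale (c1 * c2) g.
Proof. by apply/malgP => i; rewrite !fscaleE mulrA. Qed.
Fact fscale1 g : fscale 1 g = g.
Proof. by apply/malgP => i; rewrite fscaleE mul1r. Qed.
Fact fscaleDr c : {morph fscale c : g h / g + h}.
Proof. by move=> g h; apply/malgP => i; rewrite !(mcoeffD, fscaleE) mulrDr. Qed.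
Fact fscaleDl g : {morph fscale^~ g : c d / c + d}.
Proof. by move=> c d; apply/malgP => i; rewrite !(mcoeffD, fscaleE) mulrDl. Qed.

HB.instance Definition _ := GRing.Zmodule_isLmodule.Build R (freemod R I)
  fscaleA fscale1 fscaleDr fscaleDl.

Definition fgen (i : I) : freemod R I := << 1 *g i >>.

End Free.

Section Span.
Variables (R : pzRingType) (V : lmodType R) (S : V -> Prop).

Definition lspan (v : V) : Prop := exists s : seq (R * V),
  (forall p, p \in s -> S p.2) /\ v = \sum_(p <- s) p.1 *: p.2.

Definition spanb : {pred V} := fun v => `[< lspan v >].

Fact spanb_submod : submod_closed spanb.
Proof.
split; first by apply/asboolP; exists [::]; rewrite big_nil.
move=> c u v /asboolP[s [Ss ->]] /asboolP[t [St ->]]; apply/asboolP.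
exists ([seq (c * p.1, p.2) | p <- s] ++ t); split.
  by move=> p; rewrite mem_cat => /orP[/mapP[q /Ss Sq ->]|/St].
rewrite big_cat big_map scaler_sumr; congr (_ + _).
by apply: eq_bigr => p _; rewrite scalerA.
Qed.

HB.instance Definition _ := GRing.isSubmodClosed.Build R V spanb spanb_submod.

Lemma spanZ c v : lspan v -> lspan (c *: v).
Proof.
move=> Sv; have Pv : v \in spanb by apply/asboolP.
by have /asboolP := rpredZ c Pv.
Qed.

Definition quotm : Type := {quot spanb}.
HB.instance Definition _ := GRing.Zmodule.on quotm.

Definition qproj (v : V) : quotm := \pi_({quot spanb}) v.

Lemma qproj_eq u v : qproj u = qproj v <-> lspan (u - v).
Proof.
rewrite /qproj; split=> [/eqP|uv].
  by rewrite -idealrBE => /asboolP.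
by apply/eqP; rewrite -idealrBE; apply/asboolP.
Qed.

Lemma qproj_surj (q : quotm) : exists v, q = qproj v.
Proof. by exists (repr q); rewrite /qproj reprK. Qed.

Lemma qprojD u v : qproj (u + v) = qproj u + qproj v.
Proof. exact: (raddfD (\pi_({quot spanb}) : {additive V -> {quot spanb}})). Qed.

Definition qscale (c : R) (q : quotm) : quotm :=
  qproj (c *: repr (q : {quot spanb})).

Lemma qscaleE c v : qscale c (qproj v) = qproj (c *: v).
Proof.
apply/qproj_eq; rewrite -scalerBr; apply: spanZ.
by apply/qproj_eq; rewrite /qproj reprK.
Qed.

Fact qscaleA c d q : qscale c (qscale d q) = qscale (c * d) q.
Proof. by have [v ->] := qproj_surj q; rewrite !qscaleE scalerA. Qed.
Fact qscale1 q : qscale 1 q = q.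
Proof. by have [v ->] := qproj_surj q; rewrite qscaleE scale1r. Qed.
Fact qscaleDr c : {morph qscale c : p q / p + q}.
Proof.
move=> p q; have [u ->] := qproj_surj p; have [v ->] := qproj_surj q.
by rewrite -qprojD !qscaleE scalerDr qprojD.
Qed.
Fact qscaleDl q : {morph qscale^~ q : c d / c + d}.
Proof.
by move=> c d; have [v ->] := qproj_surj q; rewrite !qscaleE scalerDl qprojD.
Qed.

HB.instance Definition _ := GRing.Zmodule_isLmodule.Build R quotm
  qscaleA qscale1 qscaleDr qscaleDl.

Fact qproj_linear : linear qproj.
Proof. by move=> c u v; rewrite qprojD -qscaleE. Qed.
HB.instance Definition _ := GRing.isLinear.Build R V quotm _ qproj qproj_linear.

End Span.
Arguments qproj {R V} S.

Section Kernel.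
Variables (R : pzRingType) (V W : lmodType R) (g : {linear V -> W}).

Definition kerb : {pred V} := fun v => g v == 0.

Fact kerb_submod : submod_closed kerb.
Proof.
split; first by rewrite unfold_in linear0.
by move=> c u v; rewrite !unfold_in linearP => /eqP-> /eqP->; rewrite scaler0 addr0.
Qed.

HB.instance Definition _ := GRing.isSubmodClosed.Build R V kerb kerb_submod.

Record kerm : Type := Kerm { kerm_val :> V; _ : kerm_val \in kerb }.
HB.instance Definition _ := [isSub for kerm_val].
HB.instance Definition _ := [Choice of kerm by <:].
HB.instance Definition _ := [SubChoice_isSubLmodule of kerm by <:].

End Kernel.

Section Homology.
Variables (R : pzRingType) (U V W : lmodType R).
Variables (f : {linear U -> V}) (g : {linear V -> W}).

(* Homology at V of U -f-> V -g-> W, the classes of z in ker g modulo im f. *)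
Definition homology : lmodType R :=
  quotm (fun z : kerm g => exists u, val z = f u).

(* The class of the cycle v; it is 0 when v is not a cycle. *)
Definition hclass (v : V) : homology := qproj _ (insubd (0 : kerm g) v).

Definition coker : lmodType R := quotm (fun v => exists u, v = f u).
Definition cclass (v : V) : coker := qproj _ v.

End Homology.

(* The linear map U -> V sending gen i to f i for every i. It is only used when
   the range of gen spans U, so that there is at most one; should there be none
   it is 0. For elementary tensors and f multilinear it exists: see tens_lift. *)
Definition linext (R : pzRingType) (U V : lmodType R) (I : Type)
    (gen : I -> U) (f : I -> V) : {linear U -> V} :=
  match pselect (exists F : {linear U -> V}, forall i, F (gen i) = f i) with
  | left FP => projT1 (cid FP)
  | right _ => \0
  end.

Lemma linextE (R : pzRingType) (U V : lmodType R) (I : Type)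
    (gen : I -> U) (f : I -> V) (F : {linear U -> V}) :
  (forall i, F (gen i) = f i) -> forall i, linext gen f (gen i) = f i.
Proof.
move=> FP i; rewrite /linext; case: pselect => [FP'|[]]; last by exists F.
by case: cid.
Qed.

Lemma freemod_lift (R : pzRingType) (I : choiceType) (V : lmodType R) (f : I -> V) :
  exists F : {linear freemod R I -> V}, forall i, F (fgen R i) = f i.
Proof.
pose fl (g : freemod R I) := \sum_(i <- msupp g) g@_i *: f i.
have flw (D : {fset I}) (g : freemod R I) : (msupp g `<=` D)%fset ->
    fl g = \sum_(i <- D) g@_i *: f i.
  move=> sD; rewrite /fl (big_fset_incl _ sD) // => i _ /mcoeff_outdom ->.
  by rewrite scale0r.
have fll : linear fl.
  move=> c u v; pose D := (msupp u `|` msupp v `|` msupp (c *: u + v))%fset.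
  rewrite !(flw D) /D; first last.
  - by rewrite fsubsetUr.
  - by rewrite -fsetUA fsubsetUl.
  - by apply: fsubset_trans (fsubsetUl _ _); rewrite fsubsetUr.
  rewrite scaler_sumr -big_split; apply: eq_bigr => i _ /=.
  by rewrite mcoeffD fscaleE scalerDl scalerA.
pose FL := GRing.isLinear.Build _ _ _ _ fl fll.
pose F : {linear freemod R I -> V} := HB.pack fl FL.
exists F => i; rewrite /F /= (flw [fset i]%fset) ?msuppU_le //.
by rewrite big_seq_fset1 mcoeffUU scale1r.
Qed.

Lemma lspan_ker (R : pzRingType) (V W : lmodType R) (S : V -> Prop)
    (F : {linear V -> W}) :
  (forall v, S v -> F v = 0) -> forall v, lspan S v -> F v = 0.
Proof.
move=> FS _ [s [Ss ->]]; rewrite linear_sum big_seq big1 // => p /Ss Sp.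
by rewrite linearZ FS //= scaler0.
Qed.

Lemma quotm_lift (R : pzRingType) (V W : lmodType R) (S : V -> Prop)
    (F : {linear V -> W}) : (forall v, S v -> F v = 0) ->
  exists G : {linear quotm S -> W}, forall v, G (qproj S v) = F v.
Proof.
move=> FS; pose g (q : quotm S) := F (projT1 (cid (qproj_surj q))).
have gE v : g (qproj S v) = F v.
  rewrite /g; case: cid => w /= /esym/qproj_eq/(lspan_ker FS).
  by rewrite linearB => /eqP; rewrite subr_eq0 => /eqP.
have gl : linear g.
  move=> c p q; have [u ->] := qproj_surj p; have [v ->] := qproj_surj q.
  by rewrite -linearP !gE linearP.
pose GL := GRing.isLinear.Build _ _ _ _ g gl.
pose G : {linear quotm S -> W} := HB.pack g GL.
by exists G.
Qed.

Section Induced.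
Variables (R : pzRingType) (U V W U' V' W' : lmodType R).
Variables (f : {linear U -> V}) (g : {linear V -> W}).
Variables (f' : {linear U' -> V'}) (g' : {linear V' -> W'}).
Variable phi : V -> V'.

Definition hmap : {linear homology f g -> homology f' g'} :=
  linext (fun z : kerm g => hclass f g (val z))
         (fun z => hclass f' g' (phi (val z))).

Definition cmap : {linear coker f -> coker f'} :=
  linext (cclass f) (fun v => cclass f' (phi v)).

End Induced.

Section Powers.
Variables (R : comPzRingType) (M : lmodType R) (n : nat).

Definition upd (a : n.-tuple M) (i : 'I_n) (u : M) : n.-tuple M :=
  [tuple if j == i then u else tnth a j | j < n].

Variant multilinear_rel : freemod R (n.-tuple M) -> Prop :=
| MultilinearRel a i c u v : multilinear_rel
    (fgen R (upd a i (c *: u + v))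
       - c *: fgen R (upd a i u) - fgen R (upd a i v)).

Definition tpow : lmodType R := quotm multilinear_rel.
Definition tens (a : n.-tuple M) : tpow := qproj _ (fgen R a).

Definition multilinear (V : lmodType R) (f : n.-tuple M -> V) : Prop :=
  forall a i c u v,
    f (upd a i (c *: u + v)) = c *: f (upd a i u) + f (upd a i v).

Lemma tens_multilinear : multilinear tens.
Proof.
move=> a i c u v; rewrite /tens -linearZ -linearD; apply/qproj_eq.
exists [:: (1, fgen R (upd a i (c *: u + v))
       - c *: fgen R (upd a i u) - fgen R (upd a i v))]; split.
  by move=> p; rewrite inE => /eqP ->; exact: MultilinearRel.
by rewrite big_seq1 scale1r opprD addrA.
Qed.

Lemma tens_lift (V : lmodType R) (f : n.-tuple M -> V) : multilinear f ->
  forall a, linext tens f (tens a) = f a.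
Proof.
move=> fm; have [F FE] := freemod_lift f.
have [|G GE] := quotm_lift (S := multilinear_rel) (F := F).
  by move=> _ [a i c u v]; rewrite !linearB linearZ /= !FE fm addrAC addrK subrr.
by apply: (linextE (F := G)) => a; rewrite GE FE.
Qed.

Variant alternating_rel : freemod R (n.-tuple M) -> Prop :=
| AltMultilinear x of multilinear_rel x : alternating_rel x
| AltEq a i j of i != j & tnth a i = tnth a j : alternating_rel (fgen R a).

Definition extpow : lmodType R := quotm alternating_rel.
Definition wedge (a : n.-tuple M) : extpow := qproj _ (fgen R a).

End Powers.

(* MathComp's comAlgType only covers nonzero algebras; a commutative K-algebra is
   here a commutative ring, possibly zero, with a ring morphism from K. *)
Record comAlgebra (K : comPzRingType) := ComAlgebra {
  alg_ring : comPzRingType;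
  alg_unit : {rmorphism K -> alg_ring}
}.
Definition alg_sort (K : comPzRingType) (A : comAlgebra K) : Type := alg_ring A.
Coercion alg_sort : comAlgebra >-> Sortclass.
HB.instance Definition _ (K : comPzRingType) (A : comAlgebra K) :=
  GRing.ComPzRing.on (alg_sort A).

Definition comAlgebra_of (K : comNzRingType) (A : comAlgType K) : comAlgebra K :=
  ComAlgebra (in_alg A).

Section AlgebraModule.
Variables (K : comPzRingType) (A : comAlgebra K).

Definition alg_scale (k : K) (a : A) : A := alg_unit A k * a.

Fact alg_scaleA k l a : alg_scale k (alg_scale l a) = alg_scale (k * l) a.
Proof. by rewrite /alg_scale mulrA rmorphM. Qed.
Fact alg_scale1 a : alg_scale 1 a = a.
Proof. by rewrite /alg_scale rmorph1 mul1r. Qed.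
Fact alg_scaleDr k : {morph alg_scale k : a b / a + b}.
Proof. by move=> a b; rewrite /alg_scale mulrDr. Qed.
Fact alg_scaleDl a : {morph alg_scale^~ a : k l / k + l}.
Proof. by move=> k l; rewrite /alg_scale rmorphD mulrDl. Qed.

HB.instance Definition _ := GRing.Zmodule_isLmodule.Build K (alg_sort A)
  alg_scaleA alg_scale1 alg_scaleDr alg_scaleDl.

End AlgebraModule.

Section Restriction.
Variables (K : comPzRingType) (A : comAlgebra K).

(* Restriction of scalars along K -> A. *)
Definition restr (M : lmodType A) : Type := M.
HB.instance Definition _ (M : lmodType A) := GRing.Zmodule.on (restr M).

Variable M : lmodType A.
Definition rscale (k : K) (m : restr M) : restr M := alg_unit A k *: (m : M).

Fact rscaleA k l m : rscale k (rscale l m) = rscale (k * l) m.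
Proof. by rewrite /rscale scalerA rmorphM. Qed.
Fact rscale1 m : rscale 1 m = m.
Proof. by rewrite /rscale rmorph1 scale1r. Qed.
Fact rscaleDr k : {morph rscale k : m n / m + n}.
Proof. exact: scalerDr. Qed.
Fact rscaleDl m : {morph rscale^~ m : k l / k + l}.
Proof. by move=> k l; rewrite /rscale rmorphD [LHS]scalerDl. Qed.

HB.instance Definition _ := GRing.Zmodule_isLmodule.Build K (restr M)
  rscaleA rscale1 rscaleDr rscaleDl.

End Restriction.

Section Kaehler.
Variables (K : comPzRingType) (A : comAlgebra K).

Variant kaehler_rel : freemod A A -> Prop :=
| KaehlerLinear (k : K) (a b : A) : kaehler_rel
    (fgen A (k *: a + b) - alg_unit A k *: fgen A a - fgen A b)
| KaehlerLeibniz (a b : A) : kaehler_rel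
    (fgen A (a * b) - a *: fgen A b - b *: fgen A a).

Definition Omega1 : lmodType A := quotm kaehler_rel.
Definition dOmega (a : A) : Omega1 := qproj _ (fgen A a).

(* Omega 0 is the free A-module of rank 1 on the empty wedge, that is, A. *)
Definition Omega (p : nat) : lmodType K := restr (extpow Omega1 p).

(* a_0 da_1 ... da_p *)
Definition dform (p : nat) (a : p.+1.-tuple A) : Omega p :=
  thead a *: wedge [tuple dOmega (tnth [tuple of behead a] j) | j < p].

Definition deRham (p : nat) : {linear Omega p -> Omega p.+1} :=
  linext (@dform p) (fun a => dform [tuple of 1 :: a]).

(* The differential into degree p, from 0 when p = 0. *)
Definition deRham_in (p : nat) : {linear Omega p.-1 -> Omega p} :=
  match p with 0 => \0 | q.+1 => deRham q end.

Definition HDR (p : nat) : lmodType K := homology (deRham_in p) (deRham p).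

End Kaehler.

Section DirectSum.
Variables (K : pzRingType).

(* V n (+) V (n - 2) (+) V (n - 4) (+) ... *)
Fixpoint dsum (V : nat -> lmodType K) (n : nat) : lmodType K :=
  match n with
  | n'.+2 => (V n'.+2 * dsum V n')%type
  | _ => V n
  end.

Definition dsum_head (V : nat -> lmodType K) (n : nat) : dsum V n -> V n :=
  match n with
  | n'.+2 => fst
  | 1 | 0 => id
  end.

Fixpoint dsum_map (V W : nat -> lmodType K) (h : forall p, V p -> W p) (n : nat) :
    dsum V n -> dsum W n :=
  match n with
  | n'.+2 => fun w => (h n'.+2 w.1, dsum_map h w.2)
  | 1 => h 1
  | 0 => h 0
  end.

End DirectSum.

(* Only the data of a mixed complex: the identities b b = B B = b B + B b = 0 are
   not needed to define the homology of the total complex as ker / im. *)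
Record mixed (K : pzRingType) := Mixed {
  mobj :> nat -> lmodType K;
  mb : forall n, {linear mobj n.+1 -> mobj n};
  mB : forall n, {linear mobj n -> mobj n.+1}
}.

Section Total.
Variables (K : pzRingType) (M : mixed K).

(* (m_n, m_(n-2), ...) |-> (b m_n + B m_(n-2), b m_(n-2) + B m_(n-4), ...),
   where the last component is b m_1 for n odd; b is 0 on M 0. *)
Fixpoint tot_diff (n : nat) : dsum M n -> dsum M n.-1 :=
  match n return dsum M n -> dsum M n.-1 with
  | 0 => fun _ => 0
  | 1 => fun m => mb M 0 m
  | n'.+2 =>
    match n' return
      (dsum M n' -> dsum M n'.-1) -> dsum M n'.+2 -> dsum M n'.+1
    with
    | 0 => fun _ m => mb M 1 m.1 + mB M 0 m.2
    | k.+1 => fun D m =>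
        (mb M k.+2 m.1 + mB M k.+1 (@dsum_head K M k.+1 m.2), D m.2)
    end (@tot_diff n')
  end.

Fact dsum_head_linear n : linear (@dsum_head K M n).
Proof. by case: n => [|[|n]]. Qed.

Fact tot_diff_linear n : linear (@tot_diff n).
Proof.
suff: linear (@tot_diff n) /\ linear (@tot_diff n.+1) by case.
elim: n => [|n [IHn IHn1]].
  by split=> c u v; rewrite /= ?scaler0 ?addr0 // linearP.
split=> //; case: n IHn IHn1 => [|n] IHn IHn1 c u v /=.
  by rewrite !linearP scalerDr addrACA.
have /= -> := @dsum_head_linear n.+1 c u.2 v.2.
have /= -> := IHn c u.2 v.2.
by rewrite !linearP addrACA -scalerDr.
Qed.

HB.instance Definition _ n :=
  GRing.isLinear.Build K (dsum M n) (dsum M n.-1) _ (@tot_diff n)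
    (@tot_diff_linear n).

Definition tot_homology (n : nat) : lmodType K :=
  homology (@tot_diff n.+1) (@tot_diff n).

End Total.

Definition tot_hmap (K : pzRingType) (M N : mixed K) (h : forall p, M p -> N p)
    (n : nat) : {linear tot_homology M n -> tot_homology N n} :=
  hmap (@tot_diff K M n.+1) (@tot_diff K M n)
       (@tot_diff K N n.+1) (@tot_diff K N n) (dsum_map h (n := n)).

Section Cyclic.
Variables (K : comPzRingType) (A : comAlgebra K).

Definition Cn (n : nat) : lmodType K := tpow A n.+1.

(* (a_0, ..., a_i a_(i+1), ..., a_(n+1)) for i <= n, and
   (a_(n+1) a_0, a_1, ..., a_n) for i = n+1. *)
Definition face_tuple (n i : nat) (a : n.+2.-tuple A) : n.+1.-tuple A :=
  [tuple if (i <= n)%N then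
           if (j < i)%N then a`_j else if j == i :> nat then a`_j * a`_j.+1
           else a`_j.+1
         else if j == 0 :> nat then a`_n.+1 * a`_0 else a`_j | j < n.+1].

Definition face (n i : nat) : {linear Cn n.+1 -> Cn n} :=
  linext (@tens K A n.+2) (fun a => tens (face_tuple i a)).

Definition degen (n : nat) : {linear Cn n -> Cn n.+1} :=
  linext (@tens K A n.+1) (fun a => tens [tuple of rcons a 1]).

Definition cyc (n : nat) : {linear Cn n -> Cn n} :=
  linext (@tens K A n.+1) (fun a => (-1) ^+ n *: tens [tuple of rotr 1 a]).

Definition hoch_b (n : nat) (v : Cn n.+1) : Cn n :=
  \sum_(i < n.+2) (-1) ^+ i *: face n i v.

Definition connes_B (n : nat) (v : Cn n) : Cn n.+1 :=
  let w := cyc n.+1 (degen n (\sum_(k < n.+1) iter k (cyc n) v)) in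
  (-1) ^+ n.+1 *: (w - cyc n.+1 w).

Fact hoch_b_linear n : linear (@hoch_b n).
Proof.
move=> c u v; rewrite /hoch_b scaler_sumr -big_split; apply: eq_bigr => i _ /=.
by rewrite linearP scalerDr !scalerA mulrC.
Qed.
HB.instance Definition _ n :=
  GRing.isLinear.Build K (Cn n.+1) (Cn n) _ (@hoch_b n) (@hoch_b_linear n).

Fact connes_B_linear n : linear (@connes_B n).
Proof.
move=> c u v; rewrite /connes_B.
have -> : \sum_(k < n.+1) iter k (cyc n) (c *: u + v) =
  c *: (\sum_(k < n.+1) iter k (cyc n) u) + \sum_(k < n.+1) iter k (cyc n) v.
  rewrite scaler_sumr -big_split; apply: eq_bigr => k _ /=.
  by elim: (k : nat) => //= j ->; rewrite linearP.
rewrite !linearP addrACA -scalerDr [LHS]scalerDr !scalerA.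
by rewrite [_ * c]mulrC.
Qed.
HB.instance Definition _ n :=
  GRing.isLinear.Build K (Cn n) (Cn n.+1) _ (@connes_B n) (@connes_B_linear n).

Definition cyclic_mixed : mixed K := Mixed (@hoch_b) (@connes_B).

Definition HC (n : nat) : lmodType K := tot_homology cyclic_mixed n.

End Cyclic.

(* Sweedler notation: the sum over x_(1) (x) x_(2) = D of f (x_(1), x_(2)), and
   likewise for n factors, for f multilinear. *)
Definition sweedler (K : comPzRingType) (C V : lmodType K) (n : nat)
    (D : tpow C n) (f : n.-tuple C -> V) : V :=
  linext (@tens K C n) f D.

Record coalgebra (K : comPzRingType) := Coalgebra {
  coalg_sort :> lmodType K;
  comul : {linear coalg_sort -> tpow coalg_sort 2};
  counit : {linear coalg_sort -> K^o};
  comulA : forall x,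
    sweedler (comul x) (fun c => sweedler (comul c`_0) (fun e =>
      tens [tuple e`_0; e`_1; c`_1])) =
    sweedler (comul x) (fun c => sweedler (comul c`_1) (fun e =>
      tens [tuple c`_0; e`_0; e`_1]));
  counitl : forall x,
    sweedler (comul x) (fun c => (counit c`_0 : K) *: c`_1) = x;
  counitr : forall x,
    sweedler (comul x) (fun c => (counit c`_1 : K) *: c`_0) = x
}.
Arguments comul {K c}.
Arguments counit {K c}.

Definition cocommutative (K : comPzRingType) (C : coalgebra K) : Prop :=
  forall x : C, sweedler (comul x) (fun c => tens [tuple c`_1; c`_0]) = comul x.

(* comul_iter n x = x_(1) (x) ... (x) x_(n+1) *)
Fixpoint comul_iter (K : comPzRingType) (C : coalgebra K) (n : nat) (x : C) :
    tpow C n.+1 :=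
  match n with
  | 0 => tens [tuple x]
  | m.+1 => sweedler (comul_iter m x) (fun c => sweedler (comul (thead c))
      (fun e => tens [tuple of e ++ behead c]))
  end.

Record measuring (K : comPzRingType) (C : coalgebra K) (A A' : comAlgebra K) :=
  Measuring {
    meas :> C -> {linear A -> A'};
    meas_linear : forall (k : K) (x y : C) (a : A),
      meas (k *: x + y) a = k *: meas x a + meas y a;
    meas_mul : forall (x : C) (a b : A),
      meas x (a * b) = sweedler (comul x) (fun c => meas c`_0 a * meas c`_1 b);
    meas_one : forall x : C, meas x 1 = (counit x : K) *: (1 : A')
  }.

Section MeasuringMaps.
Variables (K : comPzRingType) (C : coalgebra K) (A A' : comAlgebra K).
Variables (Phi : measuring C A A') (x : C).

Definition meas_tuple n (c : n.-tuple C) (a : n.-tuple A) : n.-tuple A' :=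
  [tuple Phi (tnth c j) (tnth a j) | j < n].

Definition Cn_meas (n : nat) : {linear Cn A n -> Cn A' n} :=
  linext (@tens K A n.+1)
    (fun a => sweedler (comul_iter n x) (fun c => tens (meas_tuple c a))).

Definition HC_meas (n : nat) : {linear HC A n -> HC A' n} :=
  @tot_hmap K (cyclic_mixed A) (cyclic_mixed A') Cn_meas n.

Definition Omega_meas (p : nat) : {linear Omega A p -> Omega A' p} :=
  linext (@dform K A p)
    (fun a => sweedler (comul_iter p x) (fun c => dform (meas_tuple c a))).

Definition Omega_coker_meas (n : nat) :
    {linear coker (deRham_in A n) -> coker (deRham_in A' n)} :=
  cmap (deRham_in A n) (deRham_in A' n) (Omega_meas n).

Definition HDR_meas (p : nat) : {linear HDR A p -> HDR A' p} :=
  hmap (deRham_in A p) (deRham A p) (deRham_in A' p) (deRham A' p)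
    (Omega_meas p).

End MeasuringMaps.

Section Target.
Variables (K : comPzRingType) (A : comAlgebra K).

(* Omega^n / d Omega^(n-1) (+) HDR^(n-2) (+) HDR^(n-4) (+) ... *)
Definition deRham_sum (n : nat) : lmodType K :=
  match n with
  | n'.+2 => (coker (deRham_in A n'.+2) * dsum (HDR A) n')%type
  | _ => coker (deRham_in A n)
  end.

Definition Omega_mixed : mixed K :=
  @Mixed K (Omega A) (fun _ => \0) (deRham A).

(* The identification of the total homology of (Omega, 0, d) with deRham_sum,
   [(w_n, w_(n-2), ...)] |-> ([w_n], [w_(n-2)], ...). *)
Definition Omega_classes (n : nat) : dsum (Omega A) n -> deRham_sum n :=
  match n with
  | n'.+2 => fun w => (cclass (deRham_in A n'.+2) w.1,
      dsum_map (fun p => hclass (deRham_in A p) (deRham A p)) (n := n') w.2)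
  | 1 => cclass (deRham_in A 1)
  | 0 => cclass (deRham_in A 0)
  end.

Definition Omega_split (n : nat) :
    {linear tot_homology Omega_mixed n -> deRham_sum n} :=
  let d := @tot_diff K Omega_mixed in
  linext (fun z : kerm (d n) => hclass (d n.+1) (d n) (val z))
         (fun z => Omega_classes (val z)).

End Target.

Definition deRham_sum_meas (K : comPzRingType) (C : coalgebra K)
    (A A' : comAlgebra K) (Phi : measuring C A A') (x : C) (n : nat) :
    deRham_sum A n -> deRham_sum A' n :=
  match n with
  | n'.+2 => fun w => (Omega_coker_meas Phi x n'.+2 w.1,
      dsum_map (HDR_meas Phi x) (n := n') w.2)
  | 1 => Omega_coker_meas Phi x 1
  | 0 => Omega_coker_meas Phi x 0
  end.

Section Pibar.
Variables (K : fieldType) (A : comAlgebra K).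

Definition pi_fact (n : nat) : {linear Cn A n -> Omega A n} :=
  linext (@tens K A n.+1) (fun a => (n`!%:R : K)^-1 *: dform a).

Definition pibar (n : nat) : HC A n -> deRham_sum A n := fun h =>
  Omega_split A n
    (@tot_hmap K (cyclic_mixed A) (Omega_mixed A) pi_fact n h).

End Pibar.

(* Main.v *)
From HB Require Import structures.
Require Import Defs.
From mathcomp Require Import all_boot all_algebra.
From mathcomp Require Import boolp finmap monalg zify.

Set Implicit Arguments.
Unset Strict Implicit.
Unset Printing Implicit Defensive.

Import GRing.Theory.
Local Open Scope ring_scope.

(** All four maps of the square are induced by chain maps of mixed complexes, and
    already on chains the square commutes: both composites send a0 (x) ... (x) an
    to 1/n! times the sum of x_(1)(a0) d x_(2)(a1) ... d x_(n+1)(an). The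
    substance is that each map exists and respects the differentials, which is
    what the induced maps on homology and their values on classes depend on.

    Sweedler calculus. Sums over iterated coproducts are evaluated by [swsum],
    which splits off one factor at a time. Coassociativity and cocommutativity
    are then used through [swsum_split] (comultiplying a factor lengthens the sum
    by one), [swsum_swap] and [swsum_rot] (the factors may be permuted).

    Differential forms. A map out of the p-forms is determined by its values on
    products of exact forms, and [Omega_lift] says which values are possible:
    skew-symmetric functions that are derivations in the first argument. The
    target may be any A-module, and choosing it well yields the maps that are
    only linear over K. The exterior differential is the second component of an
    A-linear map into the sum of the n-forms and the (n+1)-forms, with the action
    a (w, e) = (a w, da w + a e) ([twist]). The action of C is an A-linear map into
    Hom_K(C, N), where A acts by convolution through the measuring ([chom]); the
    axioms of a derivation in Hom_K(C, N) are the measuring axiom together with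
    cocommutativity, and skew symmetry is again cocommutativity.

    Cyclic complex. The action of C on tensors commutes with the rotation by
    cocommutativity, with the interior faces by the measuring axiom, and with the
    last face because it is the zeroth face of a rotated tensor; hence with b and
    B ([Cn_meas_b], [Cn_meas_B]). The projection to forms kills b because the
    Leibniz rule makes the faces telescope ([pi_b]). It carries B to d because
    the n+1 rotations of a product of n+1 exact forms agree up to the sign of the
    cyclic operator, turning 1/(n+1)! into 1/n! ([pi_B]). *)

(** * Modules given by generators *)

Definition submodule (R : pzRingType) (V : lmodType R) (Z : V -> Prop) : Prop :=
  Z 0 /\ forall c u v, Z u -> Z v -> Z (c *: u + v).

Lemma eq_on_submodule (R : pzRingType) (V W : lmodType R) (F G : {linear V -> W}) :
  submodule (fun v => F v = G v).
Proof.
split; first by rewrite !linear0.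
by move=> c u v Fu Fv; rewrite !linearP Fu Fv.
Qed.

Lemma freemod_ind (R : pzRingType) (I : choiceType) (Z : freemod R I -> Prop) :
  submodule Z -> (forall i, Z (fgen R i)) -> forall v, Z v.
Proof.
move=> [Z0 ZP] Zgen v.
have -> : v = \sum_(i <- msupp v) (v@_i *: fgen R i).
  apply/malgP => j; rewrite raddf_sum /=.
  have cE i : (v@_i *: fgen R i)@_j = v@_i * (i == j)%:R.
    by rewrite [LHS]fscaleE mcoeffU -[LHS]/(_ * (1 *+ (i == j))).
  rewrite (eq_bigr _ (fun i _ => cE i)).
  have [jv|jv] := boolP (j \in msupp v).
    rewrite (big_fsetD1 j) //= eqxx mulr1 big_seq big1 ?addr0 // => i.
    by rewrite !inE => /andP[/negPf -> _]; rewrite mulr0.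
  rewrite mcoeff_outdom // big_seq big1 // => i iv.
  by case: eqP => [ij|]; rewrite ?mulr0 //; move: jv; rewrite -ij iv.
elim: (msupp v : seq I) => [|i s IHs]; first by rewrite big_nil.
by rewrite big_cons; exact: ZP.
Qed.

Lemma quotm_ind (R : pzRingType) (I : choiceType) (S : freemod R I -> Prop)
    (Z : quotm S -> Prop) :
  submodule Z -> (forall i, Z (qproj S (fgen R i))) -> forall q, Z q.
Proof.
move=> [Z0 ZP] Zgen q; have [v ->] := qproj_surj q.
apply: (freemod_ind (Z := fun v => Z (qproj S v))) => //.
by split=> [|c u w Zu Zw]; rewrite ?linear0 ?linearP //; exact: ZP.
Qed.

Lemma qproj_rel (R : pzRingType) (W : lmodType R) (S : W -> Prop) v :
  S v -> qproj S v = 0.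
Proof.
move=> Sv; rewrite -(linear0 (qproj S)); apply/qproj_eq; rewrite subr0.
by exists [:: (1, v)]; rewrite big_seq1 scale1r; split=> // p /[!inE] /eqP ->.
Qed.

Lemma qproj_relB (R : pzRingType) (W : lmodType R) (S : W -> Prop) u v w :
  S (u - v - w) -> qproj S u = qproj S v + qproj S w.
Proof.
by move/qproj_rel/eqP; rewrite !linearB -addrA -opprD subr_eq0 => /eqP.
Qed.

(** * Multilinear functions of lists *)

(** Arguments are kept in lists rather than in tuples, so that inserting, moving
    and deleting an argument never changes the type. *)
Definition mlin (R : comPzRingType) (M V : lmodType R) (n : nat)
    (F : seq M -> V) : Prop :=
  forall s1 s2 c u v, (size s1 + size s2).+1 = n ->
    F (s1 ++ (c *: u + v) :: s2) = c *: F (s1 ++ u :: s2) + F (s1 ++ v :: s2).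

(** The padding by 0 and truncation make a function of tuples a total function
    of lists, which is only meaningful on lists of the right length. *)
Definition tn (M : nmodType) (n : nat) (s : seq M) : n.-tuple M :=
  [tuple s`_j | j < n].

Lemma tnK (M : nmodType) n (s : seq M) : size s = n -> tn n s = s :> seq M.
Proof.
move=> sn; apply: (@eq_from_nth _ 0); rewrite size_tuple // => i lti.
by rewrite (nth_map (Ordinal lti)) ?size_enum_ord // nth_enum_ord.
Qed.

Lemma tn_tval (M : nmodType) n (a : n.-tuple M) : tn n a = a.
Proof. by apply: val_inj; rewrite /= tnK // size_tuple. Qed.

Lemma tnth_tn (M : nmodType) n (s : seq M) (i : 'I_n) : tnth (tn n s) i = s`_i.
Proof. by rewrite tnth_mktuple. Qed.

Section Mlin.
Variables (R : comPzRingType) (M : lmodType R).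

Lemma upd_val n (a : n.-tuple M) (i : 'I_n) u :
  upd a i u = take i a ++ u :: drop i.+1 a :> seq M.
Proof.
have ia : (i < size a)%N by rewrite size_tuple.
apply: (@eq_from_nth _ 0) => [|j].
  by rewrite size_tuple size_cat /= size_take size_drop ia size_tuple addnS
    -addSn subnKC.
rewrite size_tuple => jn.
rewrite -[j]/(val (Ordinal jn)) -tnth_nth tnth_mktuple nth_cat size_take ia /=.
rewrite -val_eqE /=; case: ltngtP => [ji|ij|->]; last by rewrite subnn.
  by rewrite nth_take // (tnth_nth 0).
by rewrite -[(j - i)%N]prednK ?subn_gt0 //= nth_drop (tnth_nth 0) /=
  -subnS subnKC.
Qed.

Lemma mlin_multilinear (V : lmodType R) n (F : seq M -> V) :
  mlin n F -> multilinear (fun a : n.-tuple M => F a).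
Proof.
move=> mF a i c u v; rewrite !upd_val mF //.
by rewrite size_take size_drop size_tuple ltn_ord -addSn subnKC ?ltn_ord.
Qed.

Lemma multilinear_mlin (V : lmodType R) n (f : n.-tuple M -> V) :
  multilinear f -> mlin n (fun s => f (tn n s)).
Proof.
move=> mf s1 s2 c u v sn.
have lt1 : (size s1 < n)%N by rewrite -sn ltnS leq_addr.
have tnE x : tn n (s1 ++ x :: s2) = upd (tn n (s1 ++ 0 :: s2)) (Ordinal lt1) x.
  apply: val_inj; rewrite /= upd_val !tnK ?size_cat ?addnS //=.
  by rewrite take_size_cat // -(cat_rcons 0) (drop_size_cat _ (size_rcons _ _)).
by rewrite (tnE (c *: u + v)) (tnE u) (tnE v) mf.
Qed.

Lemma mlin_cons (V : lmodType R) n (F : seq M -> V) u :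
  mlin n.+1 F -> mlin n (fun s => F (u :: s)).
Proof. by move=> mF s1 s2 c v w sn; rewrite -!cat_cons mF //= -sn. Qed.

Lemma mlin_lin0 (V : lmodType R) n (F : seq M -> V) s :
  mlin n.+1 F -> size s = n -> linear (fun u => F (u :: s)).
Proof. by move=> mF sn c u v; apply: (mF [::]); rewrite /= sn. Qed.

Lemma mlin_lin1 (V : lmodType R) n (F : seq M -> V) a s :
  mlin n.+2 F -> size s = n -> linear (fun u => F (a :: u :: s)).
Proof. by move=> mF sn c u v; apply: (mF [:: a]); rewrite /= sn. Qed.

Lemma mlinD (V : lmodType R) n (F G : seq M -> V) :
  mlin n F -> mlin n G -> mlin n (fun s => F s + G s).
Proof.
by move=> mF mG s1 s2 c u v sn; rewrite mF // mG // scalerDr addrACA.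
Qed.

Lemma mlinP (V : lmodType R) n (F G : seq M -> V) (k : R) :
  mlin n F -> mlin n G -> mlin n (fun s => k *: F s + G s).
Proof.
move=> mF mG s1 s2 c u v sn; rewrite mF // mG // !scalerDr addrACA.
by rewrite !scalerA mulrC.
Qed.

Definition tensS n (s : seq M) : tpow M n := tens (tn n s).

Lemma tensS_mlin n : mlin n (tensS n).
Proof. exact: multilinear_mlin (@tens_multilinear _ _ _). Qed.

Lemma tpow_ind n (Z : tpow M n -> Prop) :
  submodule Z -> (forall s, size s = n -> Z (tensS n s)) -> forall q, Z q.
Proof.
move=> sZ Zt; apply: quotm_ind => // a.
by rewrite -[qproj _ _]/(tens a) -(tn_tval a); apply: Zt; rewrite size_tuple.
Qed.

Lemma tpow_ext n (V : lmodType R) (F G : {linear tpow M n -> V}) :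
  (forall s, size s = n -> F (tensS n s) = G (tensS n s)) -> F =1 G.
Proof. by move=> FG; apply: tpow_ind FG; exact: eq_on_submodule. Qed.

Lemma linext_tensS n (V : lmodType R) (F : seq M -> V) s :
  mlin n F -> size s = n ->
  linext (@tens R M n) (fun a => F a) (tensS n s) = F s.
Proof.
by move=> mF sn; rewrite [LHS]tens_lift ?tnK //; exact: mlin_multilinear.
Qed.

Lemma linext_tensE n (V : lmodType R) (F : seq M -> V) (f : n.-tuple M -> V) s :
  mlin n F -> (forall a, f a = F a) -> size s = n ->
  linext (@tens R M n) f (tensS n s) = F s.
Proof. by move=> mF /funext ->; exact: linext_tensS. Qed.

End Mlin.

(** * Sweedler sums *)

Definition Lin (R : pzRingType) (V W : lmodType R) (f : V -> W)
    (lf : linear f) : {linear V -> W} :=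
  HB.pack f (GRing.isLinear.Build R V W _ f lf).

Lemma lin0 (R : pzRingType) (V W : lmodType R) (f : V -> W) :
  linear f -> f 0 = 0.
Proof. by move=> lf; exact: (linear0 (Lin lf)). Qed.

Lemma linZ (R : pzRingType) (V W : lmodType R) (f : V -> W) c u :
  linear f -> f (c *: u) = c *: f u.
Proof. by move=> lf; exact: (linearZZ (Lin lf)). Qed.

Section Sweedler.
Variables (K : comPzRingType) (C : coalgebra K).
Implicit Types (x y : C) (V W : lmodType K).

Definition bilin V (f : C -> C -> V) : Prop :=
  (forall b, linear (f^~ b)) /\ (forall a, linear (f a)).

Definition trilin V (f : C -> C -> C -> V) : Prop :=
  (forall c, bilin (fun a b => f a b c)) /\ (forall a b, linear (f a b)).

Lemma bilin_mlin V (f : C -> C -> V) : bilin f -> mlin 2 (fun s => f s`_0 s`_1).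
Proof.
move=> [fl fr] [|a [|? ?]] [|b [|? ?]] //= k u v _; [exact: fl|exact: fr].
Qed.

Lemma trilin_mlin V (f : C -> C -> C -> V) :
  trilin f -> mlin 3 (fun s => f s`_0 s`_1 s`_2).
Proof.
move=> [f12 f3] [|a [|a' [|? ?]]] [|b [|b' [|? ?]]] //= k u v _.
- by have [->] := f12 b'.
- by have [_ ->] := f12 b.
exact: f3.
Qed.

Lemma mlin_bilin V (F : seq C -> V) :
  mlin 2 F -> bilin (fun a b => F [:: a; b]).
Proof.
by move=> mF; split=> [b|a] k u v; [apply: (mF [::] [:: b])|apply: (mF [:: a])].
Qed.

Lemma mlin_trilin V (F : seq C -> V) :
  mlin 3 F -> trilin (fun a b c => F [:: a; b; c]).
Proof.
move=> mF; split=> [c|a b k u v]; last exact: (mF [:: a; b]).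
split=> [b|a] k u v; first exact: (mF [::] [:: b; c]).
exact: (mF [:: a] [:: c]).
Qed.

Lemma comul_rep x :
  exists r : seq (C * C), comul x = \sum_(e <- r) tensS 2 [:: e.1; e.2].
Proof.
move: (comul x); apply: tpow_ind.
  split; first by exists [::]; rewrite big_nil.
  move=> k _ _ [r ->] [s ->]; exists ([seq (k *: e.1, e.2) | e <- r] ++ s).
  rewrite big_cat big_map scaler_sumr; congr (_ + _); apply: eq_bigr => e _ /=.
  have [+ _] := mlin_bilin (@tensS_mlin _ C 2) => /(_ e.2) lt.
  exact: esym (linZ _ _ lt).
by move=> [|a [|b [|? ?]]] // _; exists [:: (a, b)]; rewrite big_seq1.
Qed.

(** With a manifest finite sum in place of a linear extension, exchanging and
    distributing sums needs no bilinearity. The choice of the pairs does not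
    matter for bilinear summands, by [sweedler_comul]. *)
Definition rep x : seq (C * C) := projT1 (cid (comul_rep x)).

Lemma repE x : comul x = \sum_(e <- rep x) tensS 2 [:: e.1; e.2].
Proof. by rewrite /rep; case: cid. Qed.

Lemma sweedler_comul V (f : C -> C -> V) x : bilin f ->
  sweedler (comul x) (fun c => f c`_0 c`_1) = \sum_(e <- rep x) f e.1 e.2.
Proof.
move=> /bilin_mlin bf; rewrite repE /sweedler linear_sum.
by apply: eq_bigr => e _; rewrite (linext_tensS bf).
Qed.

Lemma rep_linear V (f : C -> C -> V) :
  bilin f -> linear (fun x => \sum_(e <- rep x) f e.1 e.2).
Proof.
by move=> bf k u v; rewrite -!sweedler_comul // /sweedler !linearP.
Qed.

Lemma rep_coassoc V (f : C -> C -> C -> V) x : trilin f ->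
  \sum_(e <- rep x) \sum_(g <- rep e.1) f g.1 g.2 e.2 =
  \sum_(e <- rep x) \sum_(g <- rep e.2) f e.1 g.1 g.2.
Proof.
move=> tf; pose T (a b c : C) : tpow C 3 := tensS 3 [:: a; b; c].
have [T12 T3] : trilin T := mlin_trilin (@tensS_mlin _ C 3).
have TE (a b c : C) : tens [tuple a; b; c] = T a b c.
  by rewrite /T /tensS -(tn_tval [tuple a; b; c]).
pose L : {linear tpow C 3 -> V} := linext (@tens K C 3)
  (fun s : 3.-tuple C => f s`_0 s`_1 s`_2).
have LT a b c : L (T a b c) = f a b c.
  exact: (linext_tensS (trilin_mlin tf) (s := [:: a; b; c])).
clearbody L T.
have T23 a : bilin (fun b c => T a b c).
  by split=> [c|b]; [case: (T12 c) => _; exact|exact: T3].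
have sumT1 (c : 2.-tuple C) : sweedler (comul c`_0) (fun e =>
    tens [tuple e`_0; e`_1; c`_1]) = \sum_(g <- rep c`_0) T g.1 g.2 c`_1.
  by rewrite -(sweedler_comul _ (T12 c`_1)); congr sweedler; apply: funext.
have sumT2 (c : 2.-tuple C) : sweedler (comul c`_1) (fun e =>
    tens [tuple c`_0; e`_0; e`_1]) = \sum_(g <- rep c`_1) T c`_0 g.1 g.2.
  by rewrite -(sweedler_comul _ (T23 c`_0)); congr sweedler; apply: funext.
have bl : bilin (fun a b => \sum_(g <- rep a) T g.1 g.2 b).
  split=> [b|a k u v]; first exact: rep_linear (T12 b).
  by rewrite scaler_sumr -big_split; apply: eq_bigr => g _; exact: T3.
have br : bilin (fun a b => \sum_(g <- rep b) T a g.1 g.2).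
  split=> [b k u v|a]; last exact: rep_linear (T23 a).
  rewrite scaler_sumr -big_split; apply: eq_bigr => g _.
  by have [-> _] := T12 g.2.
have /(congr1 (sweedler (comul x))) e1 := funext sumT1.
have /(congr1 (sweedler (comul x))) e2 := funext sumT2.
have := etrans (esym e1) (etrans (comulA x) e2).
rewrite (sweedler_comul _ bl) (sweedler_comul _ br).
move/(congr1 L); rewrite !linear_sum.
under eq_bigr => e _ do rewrite linear_sum.
under [in RHS]eq_bigr => e _ do rewrite linear_sum.
under eq_bigr => e _ do under eq_bigr => g _ do rewrite LT.
by under [in RHS]eq_bigr => e _ do under eq_bigr => g _ do rewrite LT.
Qed.

Lemma rep_cocomm V (f : C -> C -> V) x : cocommutative C -> bilin f ->
  \sum_(e <- rep x) f e.2 e.1 = \sum_(e <- rep x) f e.1 e.2.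
Proof.
move=> cC bf; pose T (a b : C) : tpow C 2 := tensS 2 [:: a; b].
have [Tl Tr] : bilin T := mlin_bilin (@tensS_mlin _ C 2).
have TE (a b : C) : tens [tuple a; b] = T a b.
  by rewrite /T /tensS -(tn_tval [tuple a; b]).
pose L : {linear tpow C 2 -> V} := linext (@tens K C 2)
  (fun s : 2.-tuple C => f s`_0 s`_1).
have LT a b : L (T a b) = f a b.
  exact: (linext_tensS (bilin_mlin bf) (s := [:: a; b])).
have repT : comul x = \sum_(e <- rep x) T e.1 e.2 by exact: repE.
clearbody L T.
have TC : bilin (fun a b => T b a) by split.
have swT (c : 2.-tuple C) : tens [tuple c`_1; c`_0] = T c`_1 c`_0 by exact: TE.
have := cC x; rewrite (funext swT) (sweedler_comul _ TC) repT.
move/(congr1 L); rewrite !linear_sum.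
under eq_bigr => e _ do rewrite LT.
by under [in RHS]eq_bigr => e _ do rewrite LT.
Qed.

Lemma rep_cocommD V (f g : C -> C -> V) x : cocommutative C -> bilin g ->
  \sum_(e <- rep x) (f e.1 e.2 + g e.2 e.1) =
  \sum_(e <- rep x) (f e.1 e.2 + g e.1 e.2).
Proof. by move=> cC bg; rewrite !big_split /= (rep_cocomm x cC bg). Qed.

Lemma rep_counitl V (f : C -> V) x : linear f ->
  \sum_(e <- rep x) (counit e.1 : K) *: f e.2 = f x.
Proof.
move=> lf; have := counitl x.
rewrite (sweedler_comul (f := fun a b => (counit a : K) *: b)).
  move/(congr1 (Lin lf)); rewrite linear_sum; apply: etrans.
  by apply: eq_bigr => e _; exact: esym (linZ _ _ lf).
split=> [b|a] k u v; first by rewrite linearP scalerDl scalerA.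
by rewrite scalerDr !scalerA mulrC.
Qed.

Lemma rep_counitr V (f : C -> V) x : linear f ->
  \sum_(e <- rep x) (counit e.2 : K) *: f e.1 = f x.
Proof.
move=> lf; have := counitr x.
rewrite (sweedler_comul (f := fun a b => (counit b : K) *: a)).
  move/(congr1 (Lin lf)); rewrite linear_sum; apply: etrans.
  by apply: eq_bigr => e _; exact: esym (linZ _ _ lf).
split=> [b|a] k u v; last by rewrite linearP scalerDl scalerA.
by rewrite scalerDr !scalerA mulrC.
Qed.

(** Sweedler's sum of the F [:: x_(1); ...; x_(n)]. The leftmost factor is split
    off and the rest comultiplied further, so that an identity concerning the
    factors from some position on reduces by induction to one in front. The value
    at n = 0 is forced by counitality. *)
Fixpoint swsum V (n : nat) (F : seq C -> V) (x : C) : V :=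
  match n with
  | 0 => (counit x : K) *: F [::]
  | m.+1 => \sum_(e <- rep x) swsum m (fun s => F (e.1 :: s)) e.2
  end.

Lemma swsumS V n (F : seq C -> V) x :
  swsum n.+1 F x = \sum_(e <- rep x) swsum n (fun s => F (e.1 :: s)) e.2.
Proof. by []. Qed.

Lemma eq_swsum V n (F G : seq C -> V) x :
  (forall s, size s = n -> F s = G s) -> swsum n F x = swsum n G x.
Proof.
elim: n F G x => [|n IHn] F G x FG /=; first by rewrite FG.
by apply: eq_bigr => e _; apply: IHn => s sn; rewrite FG //= sn.
Qed.

Lemma swsumP V n (F G : seq C -> V) k x :
  swsum n (fun s => k *: F s + G s) x = k *: swsum n F x + swsum n G x.
Proof.
elim: n F G x => [|n IHn] F G x /=.
  by rewrite scalerDr !scalerA mulrC.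
by rewrite scaler_sumr -big_split; apply: eq_bigr => e _; rewrite IHn.
Qed.

Lemma linear_swsum V W (L : {linear V -> W}) n (F : seq C -> V) x :
  L (swsum n F x) = swsum n (fun s => L (F s)) x.
Proof.
elim: n F x => [|n IHn] F x /=; first by rewrite linearZ.
by rewrite linear_sum; apply: eq_bigr => e _; rewrite IHn.
Qed.

Lemma swsum_sum V (I : Type) (r : seq I) n (F : I -> seq C -> V) x :
  swsum n (fun s => \sum_(i <- r) F i s) x = \sum_(i <- r) swsum n (F i) x.
Proof.
elim: n F x => [|n IHn] F x /=; first by rewrite scaler_sumr.
by rewrite exchange_big; apply: eq_bigr => e _; rewrite IHn.
Qed.

Lemma swsum_linear V n (F : seq C -> V) : mlin n F -> linear (swsum n F).
Proof.
elim: n F => [|n IHn] F mF.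
  by move=> k u v /=; rewrite linearP scalerDl scalerA.
apply: (rep_linear (f := fun a b => swsum n (fun s => F (a :: s)) b)).
split=> [b k u v|a]; last exact/IHn/mlin_cons.
by rewrite -swsumP; apply: eq_swsum => s sn; exact: (mlin_lin0 mF).
Qed.

Lemma swsum_trilin V n (F : seq C -> V) : mlin n.+2 F ->
  trilin (fun a b c => swsum n (fun s => F [:: a, b & s]) c).
Proof.
move=> mF; split=> [c|a b]; last exact: swsum_linear (mlin_cons b (mlin_cons a mF)).
split=> [b|a] k u v; rewrite -swsumP; apply: eq_swsum => s sn.
  by apply: (mlin_lin0 mF); rewrite /= sn.
exact: (mlin_lin1 _ mF).
Qed.

Lemma swsum1 V (F : seq C -> V) x : mlin 1 F -> swsum 1 F x = F [:: x].
Proof.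
move=> mF /=; rewrite (rep_counitr (f := fun a => F [:: a])) //.
exact: (mlin_lin0 (s := [::]) mF).
Qed.

(** Comultiplying the first factor instead of the remaining ones: this is
    coassociativity. *)
Lemma swsum_split V n (F : seq C -> V) x : mlin n.+2 F ->
  swsum n.+1 (fun s => \sum_(g <- rep (head 0 s)) F [:: g.1, g.2 & behead s]) x
  = swsum n.+2 F x.
Proof.
move=> mF /=; rewrite -(rep_coassoc _ (swsum_trilin mF)).
by apply: eq_bigr => e _; rewrite swsum_sum.
Qed.

Lemma swsum_splitD V n (F G : seq C -> V) x : mlin n.+2 F -> mlin n.+2 G ->
  swsum n.+2 F x + swsum n.+2 G x =
  swsum n.+1 (fun s => \sum_(g <- rep (head 0 s))
    (F [:: g.1, g.2 & behead s] + G [:: g.1, g.2 & behead s])) x.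
Proof.
move=> mF mG; rewrite -(swsum_split x mF) -(swsum_split x mG).
rewrite -[X in X + _]scale1r -swsumP; apply: eq_swsum => s _.
by rewrite scale1r -big_split.
Qed.

(** By induction the two factors are in front. Coassociativity exhibits them as
    the coproduct of a single element, which is symmetric. *)
Lemma swsum_swap V i m (F G : seq C -> V) x : cocommutative C ->
  mlin (i + m.+2) F ->
  (forall s1 a b s2, size s1 = i -> size s2 = m ->
    G (s1 ++ [:: a, b & s2]) = F (s1 ++ [:: b, a & s2])) ->
  swsum (i + m.+2) G x = swsum (i + m.+2) F x.
Proof.
move=> cC; elim: i F G x => [|i IHi] F G x mF GF; last first.
  apply: eq_bigr => e _; apply: IHi; first exact: mlin_cons.
  by move=> s1 a b s2 s1i s2m; rewrite -!cat_cons GF //= s1i.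
have tF := swsum_trilin mF.
have tF' : trilin (fun a b c => swsum m (fun s => F [:: b, a & s]) c).
  have [F12 F3] := tF; split=> [c|a b]; last exact: F3.
  by have [Fl Fr] := F12 c; split.
rewrite /= -(rep_coassoc _ tF).
transitivity (\sum_(e <- rep x) \sum_(g <- rep e.2)
    swsum m (fun s => F [:: g.1, e.1 & s]) g.2).
  apply: eq_bigr => e _; apply: eq_bigr => g _; apply: eq_swsum => s sm.
  exact: (GF [::]).
rewrite -(rep_coassoc _ tF'); apply: eq_bigr => e _.
by have [F12 _] := tF; exact: (rep_cocomm _ cC (F12 e.2)).
Qed.

Lemma mlin_rot V n (F : seq C -> V) : mlin n.+1 F ->
  mlin n.+1 (fun s => F (rcons (behead s) (head 0 s))).
Proof.
move=> mF [|a s1] s2 k u v /= => [[sn]|[sn]].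
  by rewrite -!cats1; apply: mF; rewrite addn0 -sn.
by rewrite !rcons_cat /=; apply: mF; rewrite size_rcons addnS -sn.
Qed.

(** A rotation is a composite of exchanges of neighbours. *)
Lemma swsum_rot V n (F : seq C -> V) x : cocommutative C -> mlin n.+1 F ->
  swsum n.+1 (fun s => F (rcons (behead s) (head 0 s))) x = swsum n.+1 F x.
Proof.
move=> cC; elim: n F x => [|n IHn] F x mF.
  by apply: eq_swsum => -[|c [|? ?]].
(* the first factor is carried past the second, then to the end by induction *)
pose G s := F (head 0 s :: rcons (drop 2 s) s`_1).
have mG : mlin n.+2 G.
  move=> [|a s1] s2 k u v; first by case: s2 => // d s2 [sn]; rewrite /G /=
    drop0; apply: (mF [::]); rewrite /= size_rcons sn.
  move=> [sn]; have := mlin_rot (mlin_cons a mF) (s1 := s1) (s2 := s2) k u v.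
  by rewrite /G /= !nth0 !drop1; apply; rewrite sn.
rewrite (swsum_swap (i := 0) (m := n) (F := G)) //.
  rewrite add0n !(swsumS n.+1); apply: eq_bigr => e _.
  apply: etrans (IHn (fun s => F (e.1 :: s)) e.2 (mlin_cons _ mF)).
  by apply: eq_swsum => s _; rewrite /G /= nth0 drop1.
by move=> [|? ?] // a b s2 _ _; rewrite /G /= drop0.
Qed.

(** The iterated coproduct comultiplies the first factor again and again, the
    Sweedler sum the last one; [swsum_split] reconciles the two. *)
Lemma comul_iterE n x : comul_iter n x = swsum n.+1 (@tensS K C n.+1) x.
Proof.
elim: n x => [|n IHn] x.
  rewrite swsum1; last exact: tensS_mlin.
  by rewrite /= /tensS -(tn_tval [tuple x]).
pose G (s : seq C) : tpow C n.+2 :=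
  \sum_(g <- rep (head 0 s)) tensS n.+2 [:: g.1, g.2 & behead s].
have mG : mlin n.+1 G.
  move=> [|a s1] s2 k u v [sn]; rewrite /G /=.
    pose f (a b : C) : tpow C n.+2 := tensS n.+2 [:: a, b & s2].
    have bf : bilin f.
      split=> [b|a]; last exact: (mlin_lin1 _ (@tensS_mlin _ C n.+2)).
      by apply: (mlin_lin0 (@tensS_mlin _ C n.+2)); rewrite /= -sn.
    exact: (rep_linear bf).
  rewrite scaler_sumr -big_split; apply: eq_bigr => g _.
  by rewrite -!cat_cons tensS_mlin //= -sn.
rewrite -swsum_split; last exact: tensS_mlin.
rewrite [LHS]/= IHn /sweedler linear_swsum; apply: eq_swsum => s sn.
rewrite -[RHS]/(G s) -(linext_tensS mG sn); congr (linext _ _ _).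
apply: funext => c; case/tupleP: c => c0 c.
pose f (a b : C) : tpow C n.+2 := tensS n.+2 [:: a, b & c].
have bf : bilin f.
  split=> [b|a]; last first.
    by apply: (mlin_lin1 _ (@tensS_mlin _ C n.+2)); rewrite size_tuple.
  by apply: (mlin_lin0 (@tensS_mlin _ C n.+2)); rewrite /= size_tuple.
rewrite /G /= -(sweedler_comul _ bf) theadE; congr (sweedler _ _).
apply: funext => e; rewrite /f /tensS -(tn_tval [tuple of _]); congr (tens (tn _ _)).
by case/tupleP: e => a e; case/tupleP: e => b e; rewrite (tuple0 e).
Qed.

Lemma sweedler_iter V n (F : seq C -> V) x : mlin n.+1 F ->
  sweedler (comul_iter n x) (fun c => F c) = swsum n.+1 F x.
Proof.
move=> mF; rewrite comul_iterE /sweedler linear_swsum.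
by apply: eq_swsum => s sn; exact: linext_tensS.
Qed.

End Sweedler.

(** * Exterior powers *)

Definition skewsym (T : Type) (N : zmodType) (n : nat) (F : seq T -> N) : Prop :=
  forall s1 a b s2, (size s1 + size s2).+2 = n ->
    F (s1 ++ [:: a, b & s2]) = - F (s1 ++ [:: b, a & s2]).

Definition alternate (T : Type) (N : zmodType) (n : nat) (F : seq T -> N) :
  Prop := forall s1 u s2 s3, size (s1 ++ u :: s2 ++ u :: s3) = n ->
    F (s1 ++ u :: s2 ++ u :: s3) = 0.

Definition spanning (R : pzRingType) (M : lmodType R) (I : Type) (g : I -> M) :
  Prop := forall Z : M -> Prop, submodule Z -> (forall i, Z (g i)) ->
    forall m, Z m.

Section Exterior.
Variables (R : comPzRingType) (M : lmodType R).

Lemma mlin_alt_skew (V : lmodType R) n (F : seq M -> V) :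
  mlin n F -> alternate n F -> skewsym n F.
Proof.
move=> mF aF s1 a b s2 sn.
have sz t : size s2 = t -> (size s1 + t.+1).+1 = n.
  by move=> <-; rewrite addnS sn.
have add1 (u v : M) s : (size s1 + size s).+1 = n ->
    F (s1 ++ (u + v) :: s) = F (s1 ++ u :: s) + F (s1 ++ v :: s).
  by move=> ?; rewrite -[u in LHS]scale1r mF // scale1r.
have add2 (w u v : M) :
    F (s1 ++ w :: (u + v) :: s2) = F (s1 ++ w :: u :: s2) + F (s1 ++ w :: v :: s2).
  have := mF (rcons s1 w) s2 1 u v; rewrite !scale1r !cat_rcons; apply.
  by rewrite size_rcons addSn.
have aa (u : M) : F (s1 ++ [:: u, u & s2]) = 0.
  by apply: (aF s1 u [::] s2); rewrite size_cat /= !addnS.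
have := aa (a + b); rewrite add1 /= ?(sz (size s2)) // !add2 !aa add0r addr0.
by move/eqP; rewrite addr_eq0 => /eqP.
Qed.

(** Exchanges of neighbours bring the two equal arguments next to each other. *)
Lemma skew_alt (T : Type) (N : zmodType) n (F : seq T -> N) :
  (forall v : N, v = - v -> v = 0) -> skewsym n F -> alternate n F.
Proof.
move=> N2 sF s1 u s2; elim: s2 s1 => [|b s2 IHs] s1 s3 sn.
  by apply: N2; apply: sF; move: sn; rewrite size_cat /=; lia.
rewrite cat_cons sF; last by move: sn; rewrite !size_cat /= size_cat /=; lia.
rewrite -cat_rcons -cat_cons IHs ?oppr0 //.
by move: sn; rewrite !size_cat size_rcons /= !size_cat /=; lia.
Qed.

Lemma skew_to_head (T : Type) (N : lmodType R) n (f : seq T -> N) s1 a s2 :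
  skewsym n f -> (size s1 + size s2).+1 = n ->
  f (s1 ++ a :: s2) = (-1) ^+ size s1 *: f (a :: s1 ++ s2).
Proof.
move=> sf; elim/last_ind: s1 s2 => [|s1 b IHs] s2 sn; first by rewrite scale1r.
rewrite cat_rcons sf; last by rewrite -sn size_rcons; lia.
rewrite IHs; last by rewrite -sn size_rcons /=; lia.
by rewrite size_rcons exprS mulN1r scaleNr cat_rcons.
Qed.

(** The arguments are reduced to generators one at a time. Taking for Z the zero
    submodule gives uniqueness of multilinear extensions. *)
Lemma mlin_ind (I : Type) (g : I -> M) (V : lmodType R) (Z : V -> Prop) n
    (G : seq M -> V) :
  spanning g -> submodule Z -> mlin n G ->
  (forall s, size s = n -> Z (G (map g s))) -> forall w, size w = n -> Z (G w).
Proof.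
move=> gen [Z0 ZP]; elim: n G => [|n IHn] G mG Zg.
  by case=> // _; exact: (Zg [::]).
case=> // w ws [sn]; apply: (gen (fun w => Z (G (w :: ws)))) w.
  have lG := mlin_lin0 mG sn; split=> [|c u v Zu Zv]; last by rewrite lG; exact: ZP.
  by have -> : G (0 :: ws) = 0 := lin0 lG.
move=> i; apply: (IHn (fun s => G (g i :: s))) => //; first exact: mlin_cons.
by move=> s sz; apply: (Zg (i :: s)); rewrite /= sz.
Qed.

Lemma eq_opp_submodule (V : lmodType R) (F G : M -> V) :
  linear F -> linear G -> submodule (fun u => F u = - G u).
Proof.
move=> lF lG; split=> [|c u v Fu Fv]; first by rewrite (lin0 lF) (lin0 lG) oppr0.
by rewrite lF lG Fu Fv opprD scalerN.
Qed.

(** Skew symmetry says that a sum of two multilinear functions vanishes, but the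
    exchange of arguments obscures that; the arguments before the exchanged pair,
    the pair, and those after it are therefore reduced to generators in turn. *)
Lemma skew_gens (I : Type) (g : I -> M) (V : lmodType R) n (G : seq M -> V) :
  spanning g -> mlin n G -> skewsym n (fun s => G (map g s)) -> skewsym n G.
Proof.
move=> gen mG skG s1; elim: s1 n G mG skG => [|w s1 IHs] n G mG skG a b s2 sn.
  case: n mG skG sn => [|[|n]] // mG skG [sn].
  have mGr (c : M) : linear (fun u => G [:: c, u & s2]).
    exact: mlin_lin1 mG sn.
  have mGl (c : M) : linear (fun u => G [:: u, c & s2]).
    by apply: (mlin_lin0 mG); rewrite -sn.
  apply: (gen _ (eq_opp_submodule (mGl b) (mGr b))) a => i.
  apply: (gen _ (eq_opp_submodule (mGr (g i)) (mGl (g i)))) b => j.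
  pose F s := G [:: g i, g j & s] + G [:: g j, g i & s].
  have mF : mlin n F by exact: mlinD (mlin_cons _ (mlin_cons _ mG))
    (mlin_cons _ (mlin_cons _ mG)).
  apply/eqP; rewrite -addr_eq0 -[X in X == _]/(F s2); apply/eqP.
  apply: (mlin_ind gen _ mF (Z := fun v => v = 0)) => // [|s sz].
    by split=> // c u v -> ->; rewrite scaler0 addr0.
  by rewrite /F (skG [::] i j s) ?subrK ?addNr //= sz.
case: n mG skG sn => // n mG skG [sn].
have lG x : (size x).+1 = n.+1 -> linear (fun w => G (w :: x)).
  by move=> [sx]; exact: (mlin_lin0 mG).
have l1 : linear (fun w => G (w :: s1 ++ [:: a, b & s2])).
  by apply: lG; rewrite -sn size_cat /= !addnS.
have l2 : linear (fun w => G (w :: s1 ++ [:: b, a & s2])).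
  by apply: lG; rewrite -sn size_cat /= !addnS.
rewrite !cat_cons; apply: (gen _ (eq_opp_submodule l1 l2)) w => i.
apply: (IHs n (fun s => G (g i :: s))) => //; first exact: mlin_cons.
by move=> t1 c d t2 sz; apply: (skG (i :: t1)); rewrite /= -sz.
Qed.

Definition wedgeS n (s : seq M) : extpow M n := wedge (tn n s).

Lemma wedgeS_mlin n : mlin n (wedgeS n).
Proof.
apply: multilinear_mlin => a i c u v.
have := qproj_relB (AltMultilinear (MultilinearRel a i c u v)).
by rewrite linearZZ.
Qed.

Lemma wedgeS_alt n : alternate n (wedgeS n).
Proof.
move=> s1 u s2 s3 sn; set s := _ ++ _.
have lt1 : (size s1 < n)%N.
  by rewrite -sn size_cat -[X in (X < _)%N]addn0 ltn_add2l.
have lt2 : ((size s1 + size s2).+1 < n)%N.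
  by rewrite -sn size_cat /= size_cat /= !addnS !ltnS addnA leq_addr.
apply/qproj_rel/(@AltEq _ _ _ _ (Ordinal lt1) (Ordinal lt2)).
  by rewrite -val_eqE /= -addnS neq_ltn -[X in (X < _)%N]addn0 ltn_add2l.
rewrite !tnth_tn /= /s nth_cat ltnn subnn /= nth_cat -addnS ltnNge leq_addr /=.
by rewrite addKn /= nth_cat ltnn subnn.
Qed.

Lemma wedgeS_skew n : skewsym n (wedgeS n).
Proof. exact: mlin_alt_skew (@wedgeS_mlin n) (@wedgeS_alt n). Qed.

Lemma extpow_ind n (Z : extpow M n -> Prop) :
  submodule Z -> (forall s, size s = n -> Z (wedgeS n s)) -> forall q, Z q.
Proof.
move=> sZ Zt; apply: quotm_ind => // a.
by rewrite -[qproj _ _]/(wedge a) -(tn_tval a); apply: Zt; rewrite size_tuple.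
Qed.

Lemma extpow_lift (V : lmodType R) n (G : seq M -> V) :
  mlin n G -> alternate n G ->
  exists L : {linear extpow M n -> V},
    forall s, size s = n -> L (wedgeS n s) = G s.
Proof.
move=> mG aG; have [F FE] := freemod_lift (fun a : n.-tuple M => G a).
have altF (a : n.-tuple M) (i j : 'I_n) :
    (i < j)%N -> tnth a i = tnth a j -> G a = 0.
  move=> ij; rewrite !(tnth_nth 0) => aij.
  have jn : (j < size a)%N by rewrite size_tuple.
  have inn : (i < size (take j a))%N by rewrite size_take jn.
  have aE : tval a = take i (take j a) ++
      a`_i :: drop i.+1 (take j a) ++ a`_i :: drop j.+1 a.
    rewrite {2}aij -(drop_nth 0 jn) -cat_cons.
    by rewrite -(nth_take 0 ij) -(drop_nth 0 inn) catA !cat_take_drop.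
  by rewrite aE; apply: aG; rewrite -aE size_tuple.
have [|L LE] := quotm_lift (S := @alternating_rel R M n) (F := F); last first.
  by exists L => s sn; rewrite [LHS]LE FE tnK.
move=> _ [_ [a i c u v]|a i j ij aij].
  by rewrite !linearB linearZ /= !FE (mlin_multilinear mG) addrAC addrK subrr.
rewrite FE; move: ij; rewrite -val_eqE neq_ltn => /orP[ij|ji].
  exact: altF ij aij.
exact: altF ji (esym aij).
Qed.

Definition lwedge n (u : M) : {linear extpow M n -> extpow M n.+1} :=
  linext (@wedge R M n) (fun a => wedgeS n.+1 (u :: a)).

Lemma lwedgeE n u s : size s = n -> lwedge n u (wedgeS n s) = wedgeS n.+1 (u :: s).
Proof.
move=> sn; have mG : mlin n (fun s => wedgeS n.+1 (u :: s)).
  exact/mlin_cons/wedgeS_mlin.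
have [|L LE] := extpow_lift mG.
  move=> s1 v s2 s3 sz; apply: (@wedgeS_alt _ (u :: s1)).
  by rewrite -sz /=.
rewrite /lwedge /wedgeS (linextE (F := L)) ?tnK // => a.
by rewrite -{1}(tn_tval a) [LHS]LE // size_tuple.
Qed.

Lemma linear_comb (V W : lmodType R) c (f g : {linear V -> W}) :
  linear (fun x => c *: f x + g x).
Proof.
move=> k x z; rewrite (linearP f) (linearP g) !scalerDr addrACA !scalerA.
by rewrite [k * c]mulrC.
Qed.

Lemma lwedge_linear n w : linear (fun u => lwedge n u w).
Proof.
move=> c u v.
have lR : linear (fun x => c *: lwedge n u x + lwedge n v x).
  exact: linear_comb.
apply: (extpow_ind (eq_on_submodule (lwedge n _) (Lin lR))) w => s sn.
change (lwedge n (c *: u + v) (wedgeS n s) =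
  c *: lwedge n u (wedgeS n s) + lwedge n v (wedgeS n s)).
rewrite (lwedgeE _ sn) (lwedgeE u sn) (lwedgeE v sn).
exact: mlin_lin0 (@wedgeS_mlin _) sn _ _ _.
Qed.

End Exterior.

(** * Maps out of differential forms *)

Section KaehlerForms.
Variables (K : comPzRingType) (A : comAlgebra K).

Lemma dOmegaP (k : K) (a b : A) :
  dOmega (k *: a + b) = alg_unit A k *: dOmega a + dOmega b.
Proof.
by have := qproj_relB (KaehlerLinear k a b); rewrite linearZZ.
Qed.

Lemma dOmegaM (a b : A) : dOmega (a * b) = a *: dOmega b + b *: dOmega a.
Proof.
by have := qproj_relB (KaehlerLeibniz a b); rewrite !linearZZ.
Qed.

Lemma dOmega1 : dOmega (1 : A) = 0.
Proof.
have := dOmegaM 1 1; rewrite mulr1 scale1r => d1.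
by rewrite -[LHS](addrK (dOmega 1)) -d1 subrr.
Qed.

Lemma dOmegaD (a b : A) : dOmega (a + b) = dOmega a + dOmega b.
Proof. by have := dOmegaP 1 a b; rewrite scale1r rmorph1 scale1r. Qed.

Lemma dOmega_const (k : K) : dOmega (alg_unit A k) = 0.
Proof.
have -> : alg_unit A k = k *: (1 : A) + 0.
  by rewrite addr0 -[RHS]/(alg_unit A k * 1) mulr1.
rewrite dOmegaP dOmega1 scaler0 add0r.
have := dOmegaD 0 0; rewrite addr0 => d0.
by rewrite -[LHS](addrK (dOmega 0)) -d0 subrr.
Qed.

Lemma Omega1_spanning : spanning (@dOmega K A).
Proof. by move=> Z sZ Zd; apply: quotm_ind. Qed.

Variable N : lmodType A.

Lemma Omega1_lift (D : A -> N) :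
  (forall k a b, D (k *: a + b) = alg_unit A k *: D a + D b) ->
  (forall a b, D (a * b) = a *: D b + b *: D a) ->
  exists L : {linear Omega1 A -> N}, forall a, L (dOmega a) = D a.
Proof.
move=> Dlin Dleib; have [F FE] := freemod_lift D.
have [|L LE] := quotm_lift (S := @kaehler_rel K A) (F := F); last first.
  by exists L => a; rewrite [LHS]LE FE.
move=> _ [k a b|a b]; rewrite !linearB !(linearZZ F) !FE.
  by rewrite Dlin -addrA -opprD; exact: subrr.
by rewrite Dleib -addrA -opprD; exact: subrr.
Qed.

Definition multider n (f : seq A -> N) : Prop :=
  forall s1 s2, (size s1 + size s2).+1 = n ->
    (forall k a b, f (s1 ++ (k *: a + b) :: s2) =
       alg_unit A k *: f (s1 ++ a :: s2) + f (s1 ++ b :: s2)) /\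
    (forall a b, f (s1 ++ (a * b) :: s2) =
       a *: f (s1 ++ b :: s2) + b *: f (s1 ++ a :: s2)).

(** The arguments are extended from exact forms to all forms one at a time: the
    extension in the remaining arguments is unique, hence again a derivation in
    the one being treated. *)
Lemma multider_extend n f : multider n f ->
  exists G : seq (Omega1 A) -> N,
    mlin n G /\ forall s, size s = n -> G (map (@dOmega K A) s) = f s.
Proof.
elim: n f => [|n IHn] f mf.
  by exists (fun _ => f [::]); split=> [? ? //|[]].
have mfa a : multider n (fun s => f (a :: s)).
  move=> s1 s2 sn; have sn' : (size (a :: s1) + size s2).+1 = n.+1 by rewrite /= -sn.
  by have [] := mf _ _ sn'.
pose H a := projT1 (cid (IHn _ (mfa a))).
have mH a : mlin n (H a) by rewrite /H; case: cid => ? [].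
have HE a s : size s = n -> H a (map (@dOmega K A) s) = f (a :: s).
  by rewrite /H; case: cid => ? [? +]; apply.
have unique (F F' : seq (Omega1 A) -> N) : mlin n F -> mlin n F' ->
    (forall s, size s = n -> F (map (@dOmega K A) s) = F' (map (@dOmega K A) s)) ->
    forall w, size w = n -> F w = F' w.
  move=> mF mF' FF' w wn; apply/eqP; rewrite -subr_eq0 addrC -scaleN1r; apply/eqP.
  apply: (mlin_ind Omega1_spanning _ (mlinP (-1) mF' mF) (Z := fun v => v = 0)) wn.
    by split=> // c u v -> ->; rewrite scaler0 addr0.
  by move=> s sn; rewrite FF' // scaleN1r addNr.
have HL w : size w = n -> exists L : {linear Omega1 A -> N},
    forall a, L (dOmega a) = H a w.
  move=> wn; apply: (@Omega1_lift (fun a => H a w)).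
    move=> k a b; apply: (unique _ _ (mH _) (mlinP _ (mH a) (mH b))) wn => s sn.
    by rewrite !HE //; have [|+ _] := mf [::] s; [rewrite /= sn | apply].
  move=> a b; have mHab : mlin n (fun s => b *: H a s).
    move=> s1 s2 c u v sn; rewrite mH // scalerDr !scalerA.
    by congr (_ *: _ + _); exact: mulrC.
  apply: (unique _ _ (mH _) (mlinP a (mH b) mHab)) wn => s sn.
  rewrite !HE //.
  by have [|_ +] := mf [::] s; [rewrite /= sn | apply].
pose G (w : seq (Omega1 A)) : N :=
  linext (@dOmega K A) (fun a => H a (behead w)) (head 0 w).
have GE a w : size w = n -> G (dOmega a :: w) = H a w.
  by move=> wn; have [L LE] := HL _ wn; rewrite /G (linextE LE).
exists G; split; last first.
  by case=> // a s [sn]; rewrite /= GE ?size_map // HE.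
move=> [|w s1] s2 c u v [sn]; first by rewrite /G /= linearP.
have sz x : size (s1 ++ x :: s2) = n by rewrite size_cat /= addnS.
have Gl s : linear (fun x => G (x :: s)).
  by move=> k x y; rewrite /G /= linearP.
rewrite !cat_cons; move: w.
apply: (Omega1_spanning (eq_on_submodule (Lin (Gl _))
  (Lin (linear_comb c (Lin (Gl _)) (Lin (Gl _)))))) => a.
rewrite /= !GE //; exact: mH.
Qed.

(** The universal property of the exterior powers of the Kaehler differentials,
    in terms of exact forms only. Skew symmetry carries the conditions on the
    first argument to the others; without 2-torsion it also gives that the
    extension is alternating. *)
Lemma Omega_lift n (f : seq A -> N) :
  (forall v : N, v = - v -> v = 0) ->
  (forall k a b s, (size s).+1 = n ->
    f ((k *: a + b) :: s) = alg_unit A k *: f (a :: s) + f (b :: s)) ->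
  (forall a b s, (size s).+1 = n ->
    f ((a * b) :: s) = a *: f (b :: s) + b *: f (a :: s)) ->
  skewsym n f ->
  exists L : {linear extpow (Omega1 A) n -> N},
    forall s, size s = n -> L (wedgeS n (map (@dOmega K A) s)) = f s.
Proof.
move=> N2 flin fleib fskew.
have [|G [mG GE]] := @multider_extend n f.
  move=> s1 s2 sn; have sz : (size (s1 ++ s2)).+1 = n by rewrite size_cat.
  split=> [k a b|a b].
    rewrite !(@skew_to_head _ _ _ n _ s1) // flin // scalerDr !scalerA.
    by congr (_ *: _ + _); exact: mulrC.
  rewrite !(@skew_to_head _ _ _ n _ s1) // fleib // scalerDr !scalerA.
  by congr (_ *: _ + _ *: _); exact: mulrC.
have skG : skewsym n G.
  apply: (skew_gens Omega1_spanning mG) => s1 a b s2 sn.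
  by rewrite !GE ?size_cat /= ?addnS //; exact: fskew.
have [L LE] := extpow_lift mG (skew_alt N2 skG).
by exists L => s sn; rewrite LE ?size_map // GE.
Qed.

End KaehlerForms.

(** * The de Rham differential *)

(** A derivation D of R into Hom(E, F) twists the action on E x F so that the
    graph of a map d : E -> F is a submodule precisely when
    d(a w) = D(a)(w) + a d(w). A first-order differential operator is thereby
    obtained from a universal property over R, as the second component of a
    linear map. *)
Record hom_derivation (R : comPzRingType) (E F : lmodType R) := HomDerivation {
  hder :> R -> {linear E -> F};
  hderD : forall a b w, hder (a + b) w = hder a w + hder b w;
  hderM : forall a b w, hder (a * b) w = a *: hder b w + b *: hder a w
}.

Definition twist (R : comPzRingType) (E F : lmodType R)
  (D : hom_derivation E F) : Type := (E * F)%type.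
HB.instance Definition _ (R : comPzRingType) (E F : lmodType R)
  (D : hom_derivation E F) := GRing.Zmodule.on (twist D).

Section Twist.
Variables (R : comPzRingType) (E F : lmodType R) (D : hom_derivation E F).

Definition twscale (a : R) (w : twist D) : twist D :=
  (a *: w.1, D a w.1 + a *: w.2).

Fact twscaleA a b w : twscale a (twscale b w) = twscale (a * b) w.
Proof.
rewrite /twscale /=; congr pair; first by rewrite scalerA.
by rewrite hderM linearZZ scalerDr scalerA addrA [_ + a *: _]addrC.
Qed.
Fact twscale1 w : twscale 1 w = w.
Proof.
have D1 : D 1 w.1 = 0.
  have := hderM D 1 1 w.1; rewrite mulr1 scale1r => e.
  by rewrite -[LHS](addrK (D 1 w.1)) -e subrr.
by rewrite /twscale D1 add0r !scale1r; case: (w).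
Qed.
Fact twscaleDr a : {morph twscale a : w z / w + z}.
Proof.
move=> w z; congr pair; first exact: scalerDr.
by rewrite /= linearD scalerDr addrACA.
Qed.
Fact twscaleDl w : {morph twscale^~ w : a b / a + b}.
Proof.
move=> a b; congr pair; first exact: scalerDl.
by rewrite /= hderD scalerDl addrACA.
Qed.
HB.instance Definition _ := GRing.Zmodule_isLmodule.Build R (twist D)
  twscaleA twscale1 twscaleDr twscaleDl.

End Twist.

Section DeRham.
Variables (K : comPzRingType) (A : comAlgebra K).
Notation M := (Omega1 A).
Notation d := (@dOmega K A).

Definition dformS n (s : seq A) : Omega A n := dform (tn n.+1 s).

Lemma dformE n a s : size s = n ->
  dformS n (a :: s) = (a *: wedgeS n (map d s) : extpow M n).
Proof.
move=> sn; rewrite /dformS /dform; congr (_ *: wedge _).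
  by rewrite /thead tnth_tn.
apply: eq_from_tnth => j; rewrite tnth_mktuple tnth_tn (nth_map 0) ?sn //.
by congr (d _); rewrite (tnth_nth 0) nth_behead tnK //= sn.
Qed.

Lemma Omega_ind n (Z : Omega A n -> Prop) :
  submodule Z -> (forall s, size s = n.+1 -> Z (dformS n s)) -> forall w, Z w.
Proof.
move=> [Z0 ZP] Zd w.
have ZD u v : Z u -> Z v -> Z (u + v).
  by move=> Zu Zv; rewrite -[u]scale1r; exact: ZP.
(* Z is only closed under K; the following is closed under A *)
pose Z' (u : extpow M n) := forall a : A, Z (a *: u).
have Z'sub : submodule Z'.
  split=> [a|c u v Zu Zv a]; first by rewrite scaler0.
  by rewrite scalerDr scalerA; exact: ZD.
suff /(_ 1) : Z' w by rewrite scale1r.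
apply: extpow_ind w => // t tn.
apply: (mlin_ind (@Omega1_spanning K A) Z'sub (@wedgeS_mlin _ _ _)) tn => s sn a.
by rewrite -[_ *: _]dformE //; apply: Zd; rewrite /= sn.
Qed.

Lemma Omega_ext n (V : lmodType K) (F G : {linear Omega A n -> V}) :
  (forall s, size s = n.+1 -> F (dformS n s) = G (dformS n s)) -> F =1 G.
Proof. by move=> FG; apply: Omega_ind FG; exact: eq_on_submodule. Qed.

Fact lwedge_derD n a b (w : extpow M n) :
  lwedge n (d (a + b)) w = lwedge n (d a) w + lwedge n (d b) w.
Proof.
rewrite dOmegaD; have := lwedge_linear w 1 (d a) (d b).
by rewrite (scale1r (d a)) => e; apply: etrans e _; congr (_ + _); exact: scale1r.
Qed.
Fact lwedge_derM n a b (w : extpow M n) :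
  lwedge n (d (a * b)) w = a *: lwedge n (d b) w + b *: lwedge n (d a) w.
Proof.
rewrite dOmegaM; apply: etrans (lwedge_linear w a (d b) _) _; congr (_ + _).
exact: linZ (lwedge_linear w).
Qed.
Definition lwedge_der n : hom_derivation (extpow M n) (extpow M n.+1) :=
  HomDerivation (@lwedge_derD n) (@lwedge_derM n).

Hypothesis half : exists h : K, h *+ 2 = 1.

Lemma two_torsion_free (N : lmodType A) (v : N) : v = - v -> v = 0.
Proof.
have [h h2] := half; move=> vN.
have v2 : v *+ 2 = 0 by rewrite mulr2n {2}vN subrr.
rewrite -[v]scale1r -(rmorph1 (alg_unit A)) -h2 rmorphMn /=.
by rewrite -scalerMnl scalerMnr v2 scaler0.
Qed.

(** The zero in the second component says that products of exact forms are
    closed. Compatibility with the Leibniz rule then amounts to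
    da /\ db + db /\ da = 0. *)
Lemma twist_lift n : exists L : {linear extpow M n -> twist (lwedge_der n)},
  forall s, size s = n -> L (wedgeS n (map d s)) = (wedgeS n (map d s), 0).
Proof.
pose f (s : seq A) : twist (lwedge_der n) := (wedgeS n (map d s), 0).
apply: (Omega_lift (f := f)); first exact: two_torsion_free.
- move=> k a b s sn; congr pair; last first.
    rewrite /= dOmega_const (lin0 (lwedge_linear _)) add0r addr0.
    exact: esym (scaler0 _ _).
  rewrite /= dOmegaP; apply: (@wedgeS_mlin _ _ _ [::]).
  by rewrite size_map.
- move=> a b s sn; case: n / sn @f.
  have dsn c : size (map d (c :: s)) = (size s).+1 by rewrite size_map.
  congr pair; last first.
    rewrite /= !scaler0 !addr0 (lwedgeE _ (dsn b)) (lwedgeE _ (dsn a)) /=.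
    rewrite (@wedgeS_skew _ _ _ [::]) ?size_map //.
    exact: esym (addNr _).
  have lw := mlin_lin0 (@wedgeS_mlin _ M (size s).+1) (size_map d s).
  rewrite /= dOmegaM; apply: etrans (lw a (d b) _) _; congr (_ + _).
  exact: linZ lw.
move=> s1 a b s2 sn; congr pair; last by rewrite /= oppr0.
rewrite /= !map_cat /=; apply: wedgeS_skew.
by rewrite !size_map.
Qed.

(** The second component of the twisted map is K-linear since d kills the
    constants, and it has the prescribed values on the forms a0 da1 ... dan. *)
Lemma deRhamE n s : size s = n.+1 ->
  deRham A n (dformS n s) = dformS n.+1 (1 :: s).
Proof.
case: s => // a s [sn]; have [L LE] := twist_lift n.
pose D (w : Omega A n) : Omega A n.+1 := (L w).2.
have Dlin : linear D.
  move=> k u v; rewrite /D.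
  rewrite [L _](linearP L (alg_unit A k) (u : extpow M n)) /=.
  by rewrite dOmega_const (lin0 (lwedge_linear _)) add0r.
have DE t : size t = n.+1 -> Lin Dlin (dformS n t) = dformS n.+1 (1 :: t).
  case: t => // b t [tn]; change (D (dformS n (b :: t)) = dformS n.+1 [:: 1, b & t]).
  rewrite (@dformE n.+1 1 (b :: t)) /= ?tn // scale1r /D dformE // linearZZ LE //.
  rewrite [LHS]/= scaler0 addr0; apply: lwedgeE.
  by rewrite size_map.
rewrite /deRham /dformS (linextE (F := Lin Dlin)).
  by rewrite -(tn_tval [tuple of _]) /= tnK //= sn.
move=> t; have := DE t (size_tuple t); rewrite /dformS tn_tval => e.
by apply: etrans e _; rewrite -(tn_tval [tuple of _]).
Qed.

End DeRham.

(** * The action of a measuring on differential forms *)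

Fact amul_linear (K : comPzRingType) (A : comAlgebra K) (N : lmodType A) (a : A) :
  linear (fun w : restr N => a *: (w : N) : restr N).
Proof.
move=> k u v; rewrite [LHS]scalerDr; congr (_ + _).
rewrite -[RHS]/(alg_unit A k *: (a *: (u : N))) -[RHS]/(_ *: _).
by rewrite !scalerA [in RHS]mulrC.
Qed.

Section KMultilinearForms.
Variables (K : comPzRingType) (A : comAlgebra K).

(** The element [wedgeS n (map d s)] regarded in the K-module of forms: it is
    multilinear in s over K only. *)
Definition dwedge n (s : seq A) : Omega A n := wedgeS n (map (@dOmega K A) s).

Lemma dwedge_mlin n : mlin n (@dwedge n).
Proof.
move=> s1 s2 k a b sn; rewrite /dwedge !map_cat !map_cons dOmegaP.
by apply: (@wedgeS_mlin _ _ n); rewrite !size_map.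
Qed.

Lemma dwedge_skew n : skewsym n (@dwedge n).
Proof.
move=> s1 a b s2 sn; rewrite /dwedge !map_cat !map_cons.
by apply: (@wedgeS_skew _ _ n); rewrite !size_map.
Qed.

Definition amul n (a : A) : {linear Omega A n -> Omega A n} :=
  Lin (@amul_linear K A (extpow (Omega1 A) n) a).

Lemma amulE n a s : size s = n -> dformS n (a :: s) = amul n a (dwedge n s).
Proof. exact: dformE. Qed.

Lemma dformS_mlin n : mlin n.+1 (@dformS K A n).
Proof.
move=> [|a s1] s2 k u v [sn].
  rewrite !cat0s !amulE // -[LHS]/(((k *: u + v) : A) *: (_ : extpow _ n)).
  rewrite scalerDl; congr (_ + _).
  exact: esym (@scalerA A (extpow (Omega1 A) n) _ _ _).
have sz x : size (s1 ++ x :: s2) = n by rewrite size_cat /= addnS.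
by rewrite !cat_cons !amulE ?sz // dwedge_mlin ?linearP.
Qed.

Lemma dwedgeM n a b s : size s = n ->
  dwedge n.+1 ((a * b) :: s) =
  dformS n.+1 [:: a, b & s] + dformS n.+1 [:: b, a & s].
Proof.
move=> sn; rewrite !amulE /= ?sn // /dwedge !map_cons dOmegaM.
have lw := mlin_lin0 (@wedgeS_mlin _ (Omega1 A) n.+1)
  (etrans (size_map (@dOmega K A) s) sn).
apply: etrans (lw a (dOmega b) _) _; congr (_ + _).
exact: linZ lw.
Qed.

End KMultilinearForms.

Section Measuring.
Variables (K : comPzRingType) (C : coalgebra K) (A A' : comAlgebra K).
Variable Phi : measuring C A A'.

Lemma meas_mulE x a b :
  Phi x (a * b) = \sum_(e <- rep x) Phi e.1 a * Phi e.2 b.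
Proof.
rewrite meas_mul.
apply: (sweedler_comul (f := fun c d => Phi c a * Phi d b)).
split=> [d|c] k u v; rewrite meas_linear ?mulrDl ?mulrDr; congr (_ + _).
  exact: esym (mulrA _ _ _).
exact: mulrCA.
Qed.

Lemma meas_const x (k : K) :
  Phi x (alg_unit A k) = k *: ((counit x : K) *: (1 : A')).
Proof.
have -> : alg_unit A k = k *: (1 : A) by rewrite -[RHS]/(alg_unit A k * 1) mulr1.
by rewrite linearZZ meas_one.
Qed.

(** Hom_K(C, N). A measuring is an algebra morphism from A to the convolution
    algebra Hom_K(C, A'), over which Hom_K(C, N) is a module; thus A acts here.
    The maps indexed by the elements of C, none of them A-linear, become a single
    A-linear map into this module. *)
Record chom (N : lmodType A') : Type := Chom {
  chom_fun :> C -> restr N;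
  chom_linear : linear chom_fun
}.

HB.instance Definition _ N := gen_eqMixin (chom N).
HB.instance Definition _ N := gen_choiceMixin (chom N).

Section Action.
Variable N : lmodType A'.
Implicit Types f g h : chom N.

Lemma chom_eq f g : (forall x, f x = g x) -> f = g.
Proof.
case: f g => [f lf] [g lg] /= /funext fg; rewrite -fg in lg *.
by congr Chom; exact: Prop_irrelevance.
Qed.

Fact chadd_linear f g : linear (fun x => f x + g x).
Proof.
by move=> k u v; rewrite !chom_linear scalerDr addrACA.
Qed.
Fact chopp_linear f : linear (fun x => - f x).
Proof. by move=> k u v; rewrite chom_linear opprD scalerN. Qed.
Fact ch0_linear : linear (fun _ : C => 0 : restr N).
Proof. by move=> k u v; rewrite scaler0 addr0. Qed.

Definition chadd f g := Chom (chadd_linear f g).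
Definition chopp f := Chom (chopp_linear f).
Definition ch0 := Chom ch0_linear.

Fact chaddA : associative chadd.
Proof. by move=> f g h; apply: chom_eq => x; exact: addrA. Qed.
Fact chaddC : commutative chadd.
Proof. by move=> f g; apply: chom_eq => x; exact: addrC. Qed.
Fact chadd0 : left_id ch0 chadd.
Proof. by move=> f; apply: chom_eq => x; exact: add0r. Qed.
Fact chaddN : left_inverse ch0 chopp chadd.
Proof. by move=> f; apply: chom_eq => x; exact: addNr. Qed.

HB.instance Definition _ :=
  GRing.isZmodule.Build (chom N) chaddA chaddC chadd0 chaddN.

Definition chact (a : A) (h : chom N) (c d : C) : restr N :=
  Phi c a *: (h d : N).

Lemma chact_bilin a h : bilin (chact a h).
Proof.
split=> [d|c] k u v; rewrite /chact.
  rewrite meas_linear [LHS]scalerDl; congr (_ + _).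
  by rewrite -[RHS]/(alg_unit A' k *: _) scalerA.
rewrite chom_linear [LHS]scalerDr; congr (_ + _).
rewrite -[RHS]/(alg_unit A' k *: _) -[k *: h u]/(alg_unit A' k *: (h u : N)).
by rewrite !scalerA [in RHS]mulrC.
Qed.

Definition chscale (a : A) h : chom N := Chom (rep_linear (chact_bilin a h)).

Lemma chact_trilin a b h :
  trilin (fun c d e => Phi c a *: (Phi d b *: (h e : N)) : restr N).
Proof.
split=> [e|c d]; last first.
  move=> k u v; have [_ l1] := chact_bilin b h.
  pose h' := Chom (l1 d); have [_ l2] := chact_bilin a h'.
  exact: l2.
split=> [d|c] k u v.
  have [l1 _] := chact_bilin a (Chom ((chact_bilin b h).2 d)).
  exact: l1.
have [l1 _] := chact_bilin b h.
have [_ l2] := chact_bilin a (Chom (l1 e)).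
exact: l2.
Qed.

Fact chscaleA a b h : chscale a (chscale b h) = chscale (a * b) h.
Proof.
apply: chom_eq => x; rewrite /= /chact /=.
under eq_bigr => e _ do rewrite scaler_sumr.
rewrite -(rep_coassoc x (chact_trilin a b h)); apply: eq_bigr => e _.
rewrite meas_mulE scaler_suml; apply: eq_bigr => g _.
exact: (@scalerA A' N).
Qed.

(** Constants are measured by the counit, so the action of A extends the evident
    action of K. *)
Lemma chscale_const (k : K) h x : chscale (alg_unit A k) h x = k *: h x.
Proof.
rewrite -(rep_counitl (f := fun y => k *: h y)); last first.
  by move=> c u v; rewrite chom_linear scalerDr !scalerA mulrC.
apply: eq_bigr => e _; rewrite /chact meas_const.
have -> : k *: ((counit e.1 : K) *: (1 : A')) =
    alg_unit A' (counit e.1) * alg_unit A' k.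
  by rewrite -[LHS]/(alg_unit A' k * (alg_unit A' (counit e.1) * 1)) mulr1 mulrC.
exact: esym (@scalerA A' N _ _ _).
Qed.

Fact chscale1 h : chscale 1 h = h.
Proof.
apply: chom_eq => x; rewrite -(rmorph1 (alg_unit A)) chscale_const.
exact: scale1r.
Qed.
Fact chscaleDr a : {morph chscale a : f g / f + g}.
Proof.
move=> f g; apply: chom_eq => x /=; rewrite -big_split /=.
by apply: eq_bigr => e _; exact: (@scalerDr A' N).
Qed.
Fact chscaleDl h : {morph chscale^~ h : a b / a + b}.
Proof.
move=> a b; apply: chom_eq => x /=; rewrite -big_split /=.
by apply: eq_bigr => e _; rewrite /chact linearD; exact: (@scalerDl A' N).
Qed.

HB.instance Definition _ := GRing.Zmodule_isLmodule.Build A (chom N)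
  chscaleA chscale1 chscaleDr chscaleDl.

End Action.

(** A missing element of A counts as 0, so that the result is linear in each
    element of C whatever the lengths are. *)
Fixpoint measS (t : seq C) (s : seq A) : seq A' :=
  if t is c :: t' then Phi c (head 0 s) :: measS t' (behead s) else [::].

Lemma size_measS t s : size (measS t s) = size t.
Proof. by elim: t s => //= c t IHt s; rewrite IHt. Qed.

Lemma measS_cat t1 t2 s :
  measS (t1 ++ t2) s = measS t1 s ++ measS t2 (drop (size t1) s).
Proof.
elim: t1 s => [|c t1 IH] s /=; first by rewrite drop0.
by rewrite IH; congr (_ :: _ ++ measS _ _); rewrite -drop1 drop_drop addn1.
Qed.

Lemma measS_catr t1 t2 s1 s2 : size t1 = size s1 ->
  measS (t1 ++ t2) (s1 ++ s2) = measS t1 s1 ++ measS t2 s2.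
Proof.
by elim: t1 s1 => [|c t1 IH] [|a s1] //= [e]; rewrite IH.
Qed.

Lemma meas_tupleE n (c : n.-tuple C) (a : n.-tuple A) :
  meas_tuple Phi c a = tn n (measS c a).
Proof.
apply: eq_from_tnth => j; rewrite tnth_mktuple tnth_tn !(tnth_nth 0).
move: (j : nat) (ltn_ord j); rewrite -{1}(size_tuple c).
elim: (c : seq C) (a : seq A) => // c0 t IHt [|a0 s] [|i] //= lti.
  by rewrite -(IHt [::]) // nth_nil.
exact: IHt.
Qed.

Lemma measS_mlin (V : lmodType K) n (F : seq A' -> V) s :
  mlin n F -> mlin n (fun t => F (measS t s)).
Proof.
move=> mF t1 t2 k u v tn; rewrite !measS_cat /= meas_linear.
by apply: mF; rewrite !size_measS.
Qed.

Hypothesis half : exists h : K, h *+ 2 = 1.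
Hypothesis cocomC : cocommutative C.

Definition meas_dwedge n (s : seq A) : chom (extpow (Omega1 A') n) :=
  Chom (swsum_linear (measS_mlin s (@dwedge_mlin K A' n))).

Lemma meas_dwedgeE n s x :
  meas_dwedge n s x = swsum n (fun t => dwedge n (measS t s)) x.
Proof. by []. Qed.

Lemma chscale_dwedge n a s x : size s = n ->
  (a *: meas_dwedge n s : chom _) x =
  swsum n.+1 (fun t => dformS n (measS t (a :: s))) x.
Proof.
move=> sn; apply: eq_bigr => e _.
rewrite -[LHS]/(amul n (Phi e.1 a) (meas_dwedge n s e.2)) linear_swsum.
by apply: eq_swsum => t tn; rewrite /= amulE // size_measS.
Qed.

(** The measuring axiom expands c(ab), the Leibniz rule then gives two terms, and
    cocommutativity exchanges the two halves of c in the second. *)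
Lemma dwedge_measM n a b u c : size u = n ->
  dwedge n.+1 (Phi c (a * b) :: u) =
  \sum_(g <- rep c) (dformS n.+1 [:: Phi g.1 a, Phi g.2 b & u] +
                     dformS n.+1 [:: Phi g.1 b, Phi g.2 a & u]).
Proof.
move=> un; have bl (a1 a2 : A) :
    bilin (fun c d => dformS n.+1 [:: Phi c a1, Phi d a2 & u]).
  have lf := @dformS_mlin K A' n.+1.
  split=> [d|d] k v w; rewrite meas_linear; last exact: (mlin_lin1 _ lf).
  by apply: (mlin_lin0 lf); rewrite /= un.
transitivity (\sum_(g <- rep c) (dformS n.+1 [:: Phi g.1 a, Phi g.2 b & u] +
                                 dformS n.+1 [:: Phi g.2 b, Phi g.1 a & u]));
  last first.
  exact: (rep_cocommD (fun c d => dformS n.+1 [:: Phi c a, Phi d b & u]) c cocomC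
    (bl b a)).
rewrite meas_mulE.
have lw := mlin_lin0 (@dwedge_mlin K A' n.+1) un.
rewrite -[LHS]/(Lin lw _) linear_sum; apply: eq_bigr => g _.
exact: dwedgeM.
Qed.

Lemma meas_dwedge_leib n a b s : size s = n ->
  meas_dwedge n.+1 ((a * b) :: s) =
  (a *: meas_dwedge n.+1 (b :: s) + b *: meas_dwedge n.+1 (a :: s) :> chom _).
Proof.
move=> sn; apply: chom_eq => x.
rewrite -[RHS]/((a *: meas_dwedge n.+1 (b :: s) : chom _) x +
  (b *: meas_dwedge n.+1 (a :: s) : chom _) x).
have mF s' := measS_mlin s' (@dformS_mlin K A' n.+1).
have sn1 c : size (c :: s) = n.+1 by rewrite /= sn.
rewrite (chscale_dwedge a x (sn1 b)) (chscale_dwedge b x (sn1 a)).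
apply: etrans (esym (swsum_splitD x (mF _) (mF _))).
apply: eq_swsum => -[|c t] // [tn].
exact: dwedge_measM (etrans (size_measS _ _) tn).
Qed.

(** Exchanging two elements of A together with the two elements of C that act on
    them changes the sign; the latter exchange alone changes nothing. *)
Lemma meas_dwedge_skew n : skewsym n (meas_dwedge n).
Proof.
move=> s1 a b s2 sn; apply: chom_eq => x.
rewrite -[RHS]/(- meas_dwedge n (s1 ++ [:: b, a & s2]) x) !meas_dwedgeE.
have {sn} -> : n = (size s1 + (size s2).+2)%N by rewrite -sn !addnS.
set m := (_ + _)%N.
pose F s t := dwedge m (measS t s).
have mF s : mlin m (F s) := measS_mlin s (@dwedge_mlin K A' m).
apply: (canRL opprK).
apply: etrans (linear_swsum (-%R : {linear Omega A' m -> Omega A' m}) _ _ _) _.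
apply: (swsum_swap x cocomC (mF _)).
move=> t1 c e t2 t1s t2s; rewrite /F !measS_catr //.
apply: (canLR opprK); apply: dwedge_skew.
by rewrite !size_measS t1s t2s /m !addnS.
Qed.

Lemma Omega_meas_lift n :
  exists L : {linear extpow (Omega1 A) n -> chom (extpow (Omega1 A') n)},
    forall s, size s = n -> L (wedgeS n (map (@dOmega K A) s)) = meas_dwedge n s.
Proof.
apply: Omega_lift; first exact: two_torsion_free.
- move=> k a b s sn; case: n / sn; apply: chom_eq => x.
  rewrite -[RHS]/(chscale (alg_unit A k) (meas_dwedge _ (a :: s)) x + _).
  rewrite chscale_const !meas_dwedgeE -swsumP; apply: eq_swsum => -[|c t] // [tn].
  rewrite /= linearP.
  by rewrite (mlin_lin0 (@dwedge_mlin K A' _)) // size_measS.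
- by move=> a b s <-; exact: meas_dwedge_leib.
exact: meas_dwedge_skew.
Qed.

(** Evaluating the A-linear map at x is K-linear. On a0 da1 ... dan the
    convolution action of a0 adds the first factor of the Sweedler sum. *)
Lemma Omega_measE n x s : size s = n.+1 ->
  Omega_meas Phi x n (dformS n s) =
  swsum n.+1 (fun t => dformS n (measS t s)) x.
Proof.
have [L LE] := Omega_meas_lift n.
have Llin : linear (fun w : Omega A n => L w x : Omega A' n).
  move=> k u v; rewrite [L _](linearP L (alg_unit A k) (u : extpow _ n)).
  rewrite -[LHS]/(chscale (alg_unit A k) (L u) x + L v x).
  by rewrite chscale_const.
have LinE t : size t = n.+1 -> Lin Llin (dformS n t) =
    swsum n.+1 (fun c => dformS n (measS c t)) x.
  case: t => // a t [tn]; rewrite -[LHS]/(L _ x) dformE // linearZZ LE //.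
  exact: chscale_dwedge.
have genE (a : n.+1.-tuple A) :
    sweedler (comul_iter n x) (fun c => dform (meas_tuple Phi c a)) =
    swsum n.+1 (fun t => dformS n (measS t a)) x.
  rewrite -(sweedler_iter x (measS_mlin a (@dformS_mlin K A' n))).
  apply: (congr1 (sweedler (comul_iter n x))); apply: funext => c.
  by rewrite meas_tupleE.
move=> sn; rewrite /Omega_meas /dformS (linextE (F := Lin Llin)) => [|a].
  by rewrite genE tnK.
have := LinE a (size_tuple a); rewrite /dformS tn_tval => e.
exact: etrans e (esym (genE a)).
Qed.

End Measuring.

(** * The cyclic object on elementary tensors *)

Section CyclicOperators.
Variables (K : comPzRingType) (A : comAlgebra K).

(** An interior face. The recursion on i runs in parallel with that of [swsum],
    which reduces compatibility with a measuring to the zeroth face. *)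
Fixpoint mulS (i : nat) (s : seq A) : seq A :=
  match i, s with
  | 0, [:: a, b & s'] => a * b :: s'
  | i'.+1, a :: s' => a :: mulS i' s'
  | _, _ => s
  end.

Lemma size_mulS n i s : (i <= n)%N -> size s = n.+2 -> size (mulS i s) = n.+1.
Proof.
elim: i n s => [|i IHi] n [|a s] //= lein [sn]; first by case: s sn.
by case: n lein sn => // n lein sn; rewrite (IHi n).
Qed.

Lemma nth_mulS i s j : (i.+1 < size s)%N -> (mulS i s)`_j =
  if (j < i)%N then s`_j else if j == i then s`_j * s`_j.+1 else s`_j.+1.
Proof.
elim: i s j => [|i IHi] [|a s] [|j] //=.
- by case: s.
- by case: s.
by rewrite ltnS => lti; rewrite IHi.
Qed.

Lemma alg_mulZl (k : K) (a b : A) : (k *: a) * b = k *: (a * b).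
Proof. exact: esym (mulrA _ _ _). Qed.

Lemma alg_mulZr (k : K) (a b : A) : a * (k *: b) = k *: (a * b).
Proof. exact: mulrCA. Qed.

Lemma mulS_mlin (V : lmodType K) n i (F : seq A -> V) : (i <= n)%N ->
  mlin n.+1 F -> mlin n.+2 (fun s => F (mulS i s)).
Proof.
elim: i n F => [|i IHi] n F lein mF [|a s1] s2 k u v [sn].
- case: s2 sn => // b s2 [sn] /=.
  rewrite mulrDl alg_mulZl; apply: (mF [::]); by rewrite /= sn.
- case: s1 sn => [|b s1] sn /=; last by apply: (mF (a * b :: s1)); rewrite /= -sn.
  rewrite mulrDr alg_mulZr; apply: (mF [::]); by rewrite -sn.
- case: n lein mF sn => // n lein mF sn.
  by apply: (mF [::]); rewrite /= (@size_mulS n i _ lein).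
case: n lein mF sn => // n lein mF sn.
exact: (IHi n (fun s => F (a :: s)) lein (mlin_cons a mF) s1 s2 k u v
  (congr1 S sn)).
Qed.

Lemma mlin_rotr (M V : lmodType K) n (F : seq M -> V) :
  mlin n F -> mlin n (fun s => F (rotr 1 s)).
Proof.
move=> mF s1; elim/last_ind => [|s2 b _] k u v sn.
  rewrite !cats1 !rotr1_rcons; apply: (mF [::]).
  by rewrite -sn /= addn0.
rewrite -!rcons_cons -!rcons_cat !rotr1_rcons -!cat_cons; apply: mF.
by rewrite -sn size_rcons /= addnS.
Qed.

Lemma mlin_rcons (M V : lmodType K) n (F : seq M -> V) (a : M) :
  mlin n.+1 F -> mlin n (fun s => F (rcons s a)).
Proof.
move=> mF s1 s2 k u v sn; rewrite !rcons_cat !rcons_cons; apply: mF.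
by rewrite -sn size_rcons addnS.
Qed.

(** With the last face written through a rotation, its compatibility with a
    measuring follows from that of an interior face and of the rotation. *)
Definition faceS n i s := if (i <= n)%N then mulS i s else mulS 0 (rotr 1 s).

Lemma face_tupleE n i (a : n.+2.-tuple A) : (i <= n.+1)%N ->
  face_tuple i a = faceS n i a :> seq A.
Proof.
move=> lei; rewrite /faceS; case: leqP => [lein|ltni].
  apply: (@eq_from_nth _ 0) => [|j].
    by rewrite size_tuple (size_mulS lein) // size_tuple.
  rewrite size_tuple => ltj; rewrite -[j]/(val (Ordinal ltj)) -tnth_nth.
  rewrite tnth_mktuple lein nth_mulS //.
  by rewrite size_tuple !ltnS.
apply: (@eq_from_nth _ 0) => [|j].
  by rewrite size_tuple (size_mulS (n := n)) // size_rotr size_tuple.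
rewrite size_tuple => ltj; rewrite -[j]/(val (Ordinal ltj)) -tnth_nth.
rewrite tnth_mktuple leqNgt ltni /=.
case: a => /= s sn; elim/last_ind: s sn => // s l _.
rewrite size_rcons eqSS => /eqP sn; rewrite rotr1_rcons nth_rcons sn ltnn eqxx.
case: s sn => // b s [sn] /=; case: j ltj => [|j] //= ltj.
by rewrite nth_rcons sn -ltnS ltj.
Qed.

Lemma faceE n i s : (i <= n.+1)%N -> size s = n.+2 ->
  face A n i (tensS n.+2 s) = tensS n.+1 (faceS n i s).
Proof.
move=> lei sn; pose F s := tensS n.+1 (faceS n i s).
have mF : mlin n.+2 F.
  rewrite /F /faceS; case: leqP => [lein|_].
    exact: mulS_mlin (@tensS_mlin _ _ _).
  exact: (mlin_rotr (mulS_mlin (leq0n n) (@tensS_mlin _ _ _))).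
apply: (linext_tensE mF) sn => a.
by rewrite -[face_tuple i a]tn_tval face_tupleE.
Qed.

Lemma cycE n s : size s = n.+1 ->
  cyc A n (tensS n.+1 s) = (-1) ^+ n *: tensS n.+1 (rotr 1 s).
Proof.
move=> sn; pose F (s : seq A) := (-1) ^+ n *: tensS n.+1 (rotr 1 s) : Cn A n.
have mF : mlin n.+1 F.
  move=> s1 s2 k u v sz; rewrite /F (mlin_rotr (@tensS_mlin _ _ _)) //.
  by rewrite scalerDr !scalerA mulrC.
apply: (linext_tensE mF) sn => a.
by rewrite -[[tuple of _]]tn_tval.
Qed.

Lemma degenE n s : size s = n.+1 ->
  degen A n (tensS n.+1 s) = tensS n.+2 (rcons s 1).
Proof.
move=> sn; have mF := mlin_rcons (1 : A) (@tensS_mlin K A n.+2).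
apply: (linext_tensE mF) sn => a.
by rewrite -[[tuple of _]]tn_tval.
Qed.

Lemma cyc_degenE n s : size s = n.+1 ->
  cyc A n.+1 (degen A n (tensS n.+1 s)) = (-1) ^+ n.+1 *: tensS n.+2 (1 :: s).
Proof.
move=> sn; have sr : size (rcons s 1) = n.+2 by rewrite size_rcons sn.
by rewrite (degenE sn) (cycE sr) rotr1_rcons.
Qed.

End CyclicOperators.

Section MeasuringCyclic.
Variables (K : comPzRingType) (C : coalgebra K) (A A' : comAlgebra K).
Variable Phi : measuring C A A'.
Hypothesis cocomC : cocommutative C.
Implicit Type V : lmodType K.

Lemma measS_mlinr V n (F : seq A' -> V) t :
  mlin n F -> size t = n -> mlin n (fun s => F (measS Phi t s)).
Proof.
move=> mF tn s1 s2 k u v sn.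
have lt1 : (size s1 < size t)%N by rewrite tn -sn ltnS leq_addr.
rewrite -(cat_take_drop (size s1) t) (drop_nth 0) //.
have st : size (take (size s1) t) = size s1 by rewrite size_takel // ltnW.
rewrite !measS_catr //= linearP; apply: mF.
by rewrite !size_measS st size_drop tn -sn subSS addKn.
Qed.

Lemma Cn_measE n x s : size s = n.+1 ->
  Cn_meas Phi x n (tensS n.+1 s) =
  swsum n.+1 (fun t => tensS n.+1 (measS Phi t s)) x.
Proof.
move=> sn; pose F s := swsum n.+1 (fun t => tensS n.+1 (measS Phi t s)) x.
have mF : mlin n.+1 F.
  move=> s1 s2 k u v sz; rewrite -swsumP; apply: eq_swsum => t tn.
  exact: (measS_mlinr (@tensS_mlin _ A' n.+1) tn).
apply: (linext_tensE mF) sn => a.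
rewrite /F -(sweedler_iter x (measS_mlin Phi a (@tensS_mlin K A' n.+1))).
apply: (congr1 (sweedler (comul_iter n x))); apply: funext => c.
by rewrite meas_tupleE.
Qed.

(** The measuring axiom turns the factor acting on a product into two factors. *)
Lemma swsum_meas_mul V n i (F : seq A' -> V) x s : (i <= n)%N ->
  mlin n.+1 F -> size s = n.+2 ->
  swsum n.+1 (fun t => F (measS Phi t (mulS i s))) x =
  swsum n.+2 (fun t => F (mulS i (measS Phi t s))) x.
Proof.
elim: i n F x s => [|i IHi] n F x s lein mF sn; last first.
  case: n lein mF sn => // n lein mF; case: s => // a s [sn].
  rewrite !(swsumS n.+1) (swsumS n.+2); apply: eq_bigr => e _ /=.
  exact: (IHi n (fun s => F (Phi e.1 a :: s)) e.2 s lein (mlin_cons _ mF) sn).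
have mG := measS_mlin Phi s (mulS_mlin lein mF).
rewrite -(swsum_split x mG); apply: eq_swsum => -[|c t] // [tn].
case: s sn {mG} => [|a [|b s]] // _ /=.
have lF := mlin_lin0 mF (etrans (size_measS Phi t s) tn).
rewrite meas_mulE -[LHS]/(Lin lF _) linear_sum.
by apply: eq_bigr.
Qed.

Lemma swsum_meas_rotr V n (F : seq A' -> V) x s :
  mlin n.+1 F -> size s = n.+1 ->
  swsum n.+1 (fun t => F (measS Phi t (rotr 1 s))) x =
  swsum n.+1 (fun t => F (rotr 1 (measS Phi t s))) x.
Proof.
move=> mF; elim/last_ind: s => // s a _; rewrite size_rcons => -[sn].
have mG := measS_mlin Phi (rcons s a) (mlin_rotr mF).
rewrite -(swsum_rot x cocomC mG); apply: eq_swsum => -[|c t] // [tn].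
by rewrite rotr1_rcons -!cats1 measS_catr ?tn //= cats1 rotr1_rcons.
Qed.

(** The factor acting on 1 does so by the counit and thereby disappears. *)
Lemma swsum_meas_one V n (F : seq A' -> V) x s : mlin n.+1 F ->
  swsum n.+1 (fun t => F (measS Phi t (1 :: s))) x =
  swsum n (fun t => F (1 :: measS Phi t s)) x.
Proof.
move=> mF; have mF1 := measS_mlin Phi s (mlin_cons (1 : A') mF).
rewrite -(rep_counitl x (swsum_linear mF1)) swsumS; apply: eq_bigr => e _.
rewrite (linear_swsum ( *:%R (counit e.1 : K))); apply: eq_swsum => t tn.
have lF := mlin_lin0 mF (etrans (size_measS Phi t s) tn).
by rewrite /= meas_one; exact: linZ lF.
Qed.

Lemma Cn_meas_cyc n x v :
  Cn_meas Phi x n (cyc A n v) = cyc A' n (Cn_meas Phi x n v).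
Proof.
move: v; apply: (tpow_ext (F := Cn_meas Phi x n \o cyc A n)
  (G := cyc A' n \o Cn_meas Phi x n)) => s sn /=.
rewrite cycE // linearZZ !Cn_measE ?size_rotr //.
rewrite (swsum_meas_rotr x (@tensS_mlin _ _ _) sn) !linear_swsum.
by apply: eq_swsum => t tn; rewrite cycE // size_measS.
Qed.

Lemma Cn_meas_face n i x v : (i <= n.+1)%N ->
  Cn_meas Phi x n (face A n i v) = face A' n i (Cn_meas Phi x n.+1 v).
Proof.
move=> lei; move: v; apply: (tpow_ext (F := Cn_meas Phi x n \o face A n i)
  (G := face A' n i \o Cn_meas Phi x n.+1)) => s sn /=.
rewrite faceE // !Cn_measE // ?linear_swsum; last first.
  rewrite /faceS; case: leqP => [lein|_]; first exact: size_mulS sn.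
  by rewrite (size_mulS (leq0n n)) ?size_rotr.
transitivity (swsum n.+2 (fun t => tensS n.+1 (faceS n i (measS Phi t s))) x).
  rewrite /faceS; case: leqP => [lein|_].
    exact: swsum_meas_mul (@tensS_mlin _ _ _) sn.
  rewrite (swsum_meas_mul _ (leq0n n) (@tensS_mlin _ _ _)) ?size_rotr //.
  exact: (swsum_meas_rotr x (mulS_mlin (leq0n n) (@tensS_mlin _ _ _)) sn).
by apply: eq_swsum => t tn; rewrite faceE // size_measS.
Qed.

Lemma Cn_meas_cyc_degen n x v :
  Cn_meas Phi x n.+1 (cyc A n.+1 (degen A n v)) =
  cyc A' n.+1 (degen A' n (Cn_meas Phi x n v)).
Proof.
move: v; apply: (tpow_ext (F := Cn_meas Phi x n.+1 \o (cyc A n.+1 \o degen A n))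
  (G := cyc A' n.+1 \o (degen A' n \o Cn_meas Phi x n))) => s sn /=.
have sn1 : size ((1 : A) :: s) = n.+2 by rewrite /= sn.
rewrite cyc_degenE // linearZZ (Cn_measE x sn1) (Cn_measE x sn).
rewrite (swsum_meas_one x s (@tensS_mlin _ _ _)) !linear_swsum.
by apply: eq_swsum => t tn; rewrite [RHS]cyc_degenE // size_measS.
Qed.

Lemma Cn_meas_b n x v :
  Cn_meas Phi x n (hoch_b v) = hoch_b (Cn_meas Phi x n.+1 v).
Proof.
rewrite /hoch_b linear_sum; apply: eq_bigr => i _.
by rewrite linearZZ Cn_meas_face // -ltnS.
Qed.

Lemma Cn_meas_B n x v :
  Cn_meas Phi x n.+1 (connes_B v) = connes_B (Cn_meas Phi x n v).
Proof.
rewrite /connes_B linearZZ linearB [X in _ - X]Cn_meas_cyc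
  Cn_meas_cyc_degen linear_sum.
rewrite (eq_bigr (fun k : 'I_n.+1 => iter k (cyc A' n) (Cn_meas Phi x n v))) //.
by move=> k _; elim: (k : nat) => //= j <-; rewrite Cn_meas_cyc.
Qed.

End MeasuringCyclic.

(** * Maps induced in homology *)

Section HomologyClasses.
Variables (R : pzRingType) (U V W : lmodType R).
Variables (f : {linear U -> V}) (g : {linear V -> W}).

Lemma hclass_val (z : kerm g) : hclass f g (val z) = qproj _ z.
Proof. by rewrite /hclass valKd. Qed.

Lemma ker_val v : g v = 0 -> exists z : kerm g, v = val z.
Proof. by move=> /eqP gv; exists (Kerm (gv : v \in kerb g)). Qed.

Lemma hclass_surj (q : homology f g) : exists2 v, g v = 0 & q = hclass f g v.
Proof.
have [z ->] := qproj_surj q; exists (val z); last by rewrite hclass_val.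
by apply/eqP; case: z.
Qed.

Lemma hclass_linear c u v : g u = 0 -> g v = 0 ->
  hclass f g (c *: u + v) = c *: hclass f g u + hclass f g v.
Proof.
move=> /ker_val[y ->] /ker_val[z ->].
have -> : c *: val y + val z = val (c *: y + z) by rewrite linearP.
by rewrite !hclass_val linearP.
Qed.

Lemma hclass_im u : hclass f g (f u) = 0.
Proof.
have [gfu|gfu] := eqVneq (g (f u)) 0.
  have [z ez] := ker_val gfu; rewrite ez hclass_val.
  by apply: qproj_rel; exists u.
by rewrite /hclass /insubd insubN ?unfold_in //= linear0.
Qed.

(** F need not be linear on all of V: [hclass] itself is linear on cycles only. *)
Lemma hclass_lift (X : lmodType R) (F : V -> X) :
  (forall c u v, g u = 0 -> g v = 0 -> F (c *: u + v) = c *: F u + F v) ->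
  (forall u, F (f u) = 0) ->
  forall v, g v = 0 ->
    linext (fun z : kerm g => hclass f g (val z)) (fun z => F (val z))
      (hclass f g v) = F v.
Proof.
move=> Flin Fim v /ker_val[z ->].
have gz (y : kerm g) : g (val y) = 0 by apply/eqP; case: y.
have lF : linear (fun y : kerm g => F (val y)).
  by move=> c y y'; rewrite linearP; apply: Flin; exact: gz.
have [|G GE] := quotm_lift (S := fun z : kerm g => exists u, val z = f u)
  (F := Lin lF).
  by move=> y [u yu]; rewrite /= yu Fim.
apply: (linextE (F := G)) => y.
by rewrite hclass_val GE.
Qed.

Lemma cclass_im u : cclass f (f u) = 0.
Proof. by apply: qproj_rel; exists u. Qed.

Lemma cclass_linear : linear (cclass f).
Proof. by move=> c u v; rewrite /cclass linearP. Qed.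

End HomologyClasses.

Section HomologyMaps.
Variables (R : pzRingType) (U V W U' V' W' : lmodType R).
Variables (f : {linear U -> V}) (g : {linear V -> W}).
Variables (f' : {linear U' -> V'}) (g' : {linear V' -> W'}).

Lemma hmapE (phi : V -> V') v : linear phi ->
  (forall u, g u = 0 -> g' (phi u) = 0) ->
  (forall u, exists u', phi (f u) = f' u') -> g v = 0 ->
  hmap f g f' g' phi (hclass f g v) = hclass f' g' (phi v).
Proof.
move=> lphi ker im; apply: (hclass_lift (F := fun v => hclass f' g' (phi v))).
  by move=> c u w gu gw; rewrite lphi hclass_linear ?ker.
by move=> u; have [u' ->] := im u; exact: hclass_im.
Qed.

Lemma cmapE (phi : V -> V') v : linear phi ->
  (forall u, exists u', phi (f u) = f' u') ->
  cmap f f' phi (cclass f v) = cclass f' (phi v).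
Proof.
move=> lphi im; have lF : linear (fun v => cclass f' (phi v)).
  by move=> c u w; rewrite lphi /cclass linearP.
have [|G GE] := quotm_lift (S := fun v => exists u, v = f u) (F := Lin lF).
  by move=> _ [u ->]; have [u' e] := im u; rewrite /= e; apply: qproj_rel; exists u'.
exact: (linextE (F := G)).
Qed.

End HomologyMaps.

Section MixedMaps.
Variables (K : pzRingType).

Lemma dsum_map_linear (V W : nat -> lmodType K) (h : forall p, V p -> W p) n :
  (forall p, linear (h p)) -> linear (dsum_map h (n := n)).
Proof.
(* the direct sum recurses by two, so consecutive degrees go together *)
move=> lh; suff : linear (dsum_map h (n := n)) /\ linear (dsum_map h (n := n.+1)).
  by case.
elim: n => [|n [IHn IHn1]]; first by split; exact: lh.
by split=> // c u v /=; rewrite lh IHn.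
Qed.

Variables (M N : mixed K) (h : forall p, M p -> N p).
Arguments h : clear implicits.
Hypothesis h_linear : forall p, linear (h p).
Hypothesis h_b : forall n v, h n (mb M n v) = mb N n (h n.+1 v).
Hypothesis h_B : forall n v, h n.+1 (mB M n v) = mB N n (h n v).

Lemma dsum_map_diff n (v : dsum M n) :
  dsum_map h (tot_diff v) = tot_diff (dsum_map h v).
Proof.
have hD p u v' : h p (u + v') = h p u + h p v'.
  by have := @h_linear p 1 u v'; rewrite !scale1r.
have headE p (u : dsum M p) : h p (dsum_head u) = dsum_head (dsum_map h u).
  by case: p u => [|[|p]].
suff [] : (forall v : dsum M n,
      dsum_map h (tot_diff v) = tot_diff (dsum_map h v)) /\
    (forall v : dsum M n.+1,
      dsum_map h (tot_diff v) = tot_diff (dsum_map h v)) by [].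
elim: n {v} => [|n [IHn IHn1]].
  by split=> v /=; [exact: lin0 (@h_linear 0)|exact: h_b].
split=> //; case: n IHn IHn1 => [|n] IHn IHn1 v /=.
  by rewrite hD h_b h_B.
by rewrite hD h_b h_B (headE n.+1) IHn.
Qed.

Lemma tot_hmapE n (z : dsum M n) : tot_diff z = 0 ->
  tot_hmap h n (hclass (@tot_diff K M n.+1) (@tot_diff K M n) z) =
  hclass (@tot_diff K N n.+1) (@tot_diff K N n) (dsum_map h z).
Proof.
move=> z0; have ld p := @dsum_map_linear M N h p h_linear.
apply: hmapE => //.
  by move=> u u0; rewrite -[LHS]dsum_map_diff u0; exact: lin0 (ld _).
by move=> u; exists (dsum_map h u); exact: (@dsum_map_diff n.+1).
Qed.

End MixedMaps.

Section DeRhamTotal.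
Variables (K : comPzRingType) (A : comAlgebra K).

Fixpoint dclosed n : dsum (Omega A) n -> Prop :=
  match n with
  | n'.+2 => fun w => deRham A n'.+2 w.1 = 0 /\ dclosed w.2
  | 1 => fun w => deRham A 1 w = 0
  | 0 => fun w => deRham A 0 w = 0
  end.

Notation D n := (@tot_diff K (Omega_mixed A) n).

(** As b = 0 for differential forms, the differential of the total complex
    applies d to every component but the first. *)
Lemma cycle_dclosed n (w : dsum (Omega A) n.+2) : D n.+2 w = 0 -> @dclosed n w.2.
Proof.
suff [] : (forall w : dsum (Omega A) n.+2, D n.+2 w = 0 -> @dclosed n w.2) /\
  (forall w : dsum (Omega A) n.+3, D n.+3 w = 0 -> @dclosed n.+1 w.2)
  by move=> + _; exact.
elim: n {w} => [|n [IHn IHn1]].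
  split=> -[w1 w2] /=; first by rewrite add0r.
  by move=> /(congr1 fst) /=; rewrite add0r.
split=> //; case=> [w1 w2] e /=; split; last first.
  apply: IHn.
  exact: (congr1 (fun z : (Omega A n.+3 * dsum (Omega A) n.+1)%type => z.2) e).
by have := congr1 fst e; rewrite /= add0r.
Qed.

Notation hcl := (fun p => hclass (deRham_in A p) (deRham A p)).

Lemma dsum_hclass_linear n c (u v : dsum (Omega A) n) : dclosed u -> dclosed v ->
  dsum_map hcl (c *: u + v) = c *: dsum_map hcl u + dsum_map hcl v.
Proof.
move: u v; suff [] : (forall u v : dsum (Omega A) n, dclosed u -> dclosed v ->
    dsum_map hcl (c *: u + v) = c *: dsum_map hcl u + dsum_map hcl v) /\
  (forall u v : dsum (Omega A) n.+1, dclosed u -> dclosed v ->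
    dsum_map hcl (c *: u + v) = c *: dsum_map hcl u + dsum_map hcl v) by [].
elim: n => [|n [IHn IHn1]]; first by split=> u v; exact: hclass_linear.
split=> // -[u1 u2] [v1 v2] [du1 du2] [dv1 dv2]; apply: (congr2 pair).
  exact: hclass_linear.
exact: IHn.
Qed.

Lemma dsum_hclass_diff n (u : dsum (Omega A) n.+1) :
  dsum_map hcl (D n.+1 u) = 0 :> dsum (HDR A) n.
Proof.
suff [] : (forall u : dsum (Omega A) n.+1,
    dsum_map hcl (D n.+1 u) = 0 :> dsum (HDR A) n) /\
  (forall u : dsum (Omega A) n.+2,
    dsum_map hcl (D n.+2 u) = 0 :> dsum (HDR A) n.+1) by [].
have cl0 p : hcl p 0 = 0.
  by rewrite -(linear0 (deRham_in A p)) hclass_im.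
elim: n {u} => [|n [IHn IHn1]].
  split=> u; first exact: cl0.
  apply: etrans (hclass_im (deRham A 0) (deRham A 1) u.2).
  exact: congr1 (add0r _).
split=> // -[u1 u2]; apply: (congr2 pair); last exact: IHn.
apply: etrans (hclass_im (deRham A n.+1) (deRham A n.+2)
  (@dsum_head K (Omega A) n.+1 u2)).
exact: congr1 (add0r _).
Qed.

Lemma Omega_splitE n (w : dsum (Omega A) n) : D n w = 0 ->
  Omega_split A n (hclass (D n.+1) (D n) w) = Omega_classes w.
Proof.
have lin c (u v : dsum (Omega A) n) : D n u = 0 -> D n v = 0 ->
    Omega_classes (c *: u + v) = c *: Omega_classes u + Omega_classes v.
  case: n u v {w} => [|[|n]] u v; try by move=> _ _; exact: cclass_linear.
  move=> /cycle_dclosed du /cycle_dclosed dv; apply: (congr2 pair).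
    exact: cclass_linear.
  exact: dsum_hclass_linear.
have im (u : dsum (Omega A) n.+1) : Omega_classes (D n.+1 u) = 0.
  case: n u {w lin} => [|[|n]] u.
  - exact: (cclass_im (deRham_in A 0) 0).
  - apply: etrans (cclass_im (deRham A 0) u.2).
    exact: congr1 (add0r _).
  apply: (congr2 pair); last exact: dsum_hclass_diff.
  apply: etrans (cclass_im (deRham A n.+1) (@dsum_head K (Omega A) n.+1 u.2)).
  exact: congr1 (add0r _).
exact: (@hclass_lift K _ _ _ (D n.+1) (D n) _ _ lin im w).
Qed.

End DeRhamTotal.

(** * From the cyclic complex to differential forms *)

Lemma telescope_alternating (R : pzRingType) (V : lmodType R) (u : nat -> V) n :
  u 0 + \sum_(j < n) (-1) ^+ j.+1 *: (u j + u j.+1) + (-1) ^+ n.+1 *: u n = 0.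
Proof.
elim: n => [|n IHn]; first by rewrite big_ord0 addr0 expr1 scaleN1r subrr.
rewrite big_ord_recr /= scalerDr !addrA -[RHS]IHn -!addrA; congr (_ + _).
congr (_ + _); rewrite -[RHS]addr0; congr (_ + _).
by rewrite -scalerDl [_ ^+ n.+2]exprS mulN1r subrr scale0r.
Qed.

Lemma scaler_swap (R : comPzRingType) (V : lmodType R) (a b : R) (v : V) :
  a *: (b *: v) = b *: (a *: v).
Proof. by rewrite !scalerA mulrC. Qed.

Lemma scaler_signK (R : pzRingType) (V : lmodType R) n (v : V) :
  (-1) ^+ n *: ((-1) ^+ n *: v) = v.
Proof. by rewrite scalerA -expr2 sqrr_sign scale1r. Qed.

Lemma scaler_sign_cancel (R : comPzRingType) (V : lmodType R) (a b : R) (v : V) n :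
  (-1) ^+ n *: (a *: (b *: ((-1) ^+ n *: v))) = a *: (b *: v).
Proof.
by rewrite [b *: (_ *: v)]scaler_swap [a *: (_ *: (b *: v))]scaler_swap scaler_signK.
Qed.

Lemma sum_const_ord (V : nmodType) n (F : 'I_n -> V) v :
  (forall k, F k = v) -> \sum_(k < n) F k = v *+ n.
Proof. by move=> e; rewrite (eq_bigr _ (fun k _ => e k)) sumr_const card_ord. Qed.

Section HochschildForms.
Variables (K : comPzRingType) (A : comAlgebra K).
Implicit Types (a b : A) (s : seq A).

Lemma dwedge_leib n s1 a b s2 : (size s1 + size s2).+1 = n ->
  dwedge n (s1 ++ (a * b) :: s2) =
  amul n a (dwedge n (s1 ++ b :: s2)) + amul n b (dwedge n (s1 ++ a :: s2)).
Proof.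
move=> sn; rewrite /dwedge !map_cat !map_cons dOmegaM.
have lw : linear (fun u => wedgeS n (map (@dOmega K A) s1 ++ u ::
    map (@dOmega K A) s2)).
  by move=> c u v; apply: wedgeS_mlin; rewrite !size_map.
apply: etrans (lw a (dOmega b) _) _; congr (_ + _).
exact: linZ lw.
Qed.

Lemma mulS_cat s1 a b s2 :
  mulS (size s1) (s1 ++ [:: a, b & s2]) = s1 ++ (a * b) :: s2 :> seq A.
Proof. by elim: s1 => //= c s1 ->. Qed.

(** In the image of the Hochschild boundary, every product in an interior face
    is opened by the Leibniz rule, and the two halves cancel against the
    neighbouring faces. *)
Lemma dformS_hoch_b n s : size s = n.+2 ->
  \sum_(i < n.+2) (-1) ^+ i *: dformS n (faceS n i s) = 0 :> Omega A n.
Proof.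
case: s => // a s [sn].
pose u j := amul n (a * s`_j) (dwedge n (take j s ++ drop j.+1 s)).
have mid j : (j < n)%N -> dformS n (faceS n j.+1 (a :: s)) = u j + u j.+1.
  move=> jn; rewrite /faceS jn /=.
  have j1s : (j.+1 < size s)%N by rewrite sn ltnS.
  have js : (j < size s)%N := ltnW j1s.
  have sE : s = take j s ++ [:: s`_j, s`_j.+1 & drop j.+2 s].
    by rewrite -(drop_nth 0 j1s) -(drop_nth 0 js) cat_take_drop.
  have tj : size (take j s) = j by rewrite size_takel // ltnW.
  have mE : mulS j s = take j s ++ (s`_j * s`_j.+1) :: drop j.+2 s.
    by rewrite {1}sE -{1}tj mulS_cat.
  have szn : (size (take j s) + size (drop j.+2 s)).+1 = n.
    by rewrite tj size_drop sn; lia.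
  rewrite mE amulE; last by rewrite size_cat /= addnS.
  rewrite dwedge_leib // linearD /u; congr (_ + _).
    rewrite (drop_nth 0 j1s).
    exact: (@scalerA A (extpow (Omega1 A) n)).
  rewrite (take_nth 0 js) cat_rcons.
  exact: (@scalerA A (extpow (Omega1 A) n)).
have first : dformS n (faceS n 0 (a :: s)) = u 0.
  rewrite /faceS leq0n; case: s sn {mid} @u => [|b s] sn u; first discriminate sn.
  case: sn => sn; rewrite [mulS _ _]/= /u [drop _ _]/= drop0; exact: amulE.
have last : dformS n (faceS n n.+1 (a :: s)) = u n.
  rewrite /faceS ltnn; case/lastP: s sn {mid first} @u => [|s l] sn u.
    discriminate sn.
  move: sn; rewrite size_rcons => -[sn]; rewrite -rcons_cons rotr1_rcons [mulS _ _]/= /u.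
  rewrite nth_rcons sn ltnn eqxx mulrC -cats1 (take_size_cat _ sn).
  rewrite drop_oversize ?cats0; first exact: amulE.
  by rewrite size_cat sn addn1.
rewrite big_ord_recl big_ord_recr /= scale1r first last addrA.
rewrite -[RHS](telescope_alternating u n); congr (_ + _ + _).
by apply: eq_bigr => j _; rewrite mid.
Qed.

(** The last factor moves past n others. *)
Lemma dwedge_rotr n s : size s = n.+1 ->
  dwedge n.+1 (rotr 1 s) = (-1) ^+ n *: dwedge n.+1 s :> Omega A n.+1.
Proof.
elim/last_ind: s => // s l _; rewrite size_rcons => -[sn].
have sz : (size s + size (Nil A)).+1 = n.+1 by rewrite addn0 sn.
rewrite rotr1_rcons -cats1 (skew_to_head l (@dwedge_skew K A n.+1) sz) sn cats0.
by rewrite scalerA -expr2 sqrr_sign scale1r.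
Qed.

Lemma dform_one n s : size s = n -> dformS n (1 :: s) = dwedge n s :> Omega A n.
Proof.
by move=> sn; rewrite amulE //; exact: (@scale1r A (extpow (Omega1 A) n)).
Qed.

End HochschildForms.

Section Antisymmetrization.
Variables (K : fieldType) (A : comAlgebra K).
Implicit Types (s : seq A).

Lemma pi_factE n s : size s = n.+1 ->
  pi_fact A n (@tensS K A n.+1 s) = (n`!%:R : K)^-1 *: @dformS K A n s.
Proof.
move=> sn; pose F s := (n`!%:R : K)^-1 *: @dformS K A n s : Omega A n.
have mF : mlin n.+1 F.
  move=> s1 s2 k u v sz; rewrite /F dformS_mlin // scalerDr !scalerA.
  by rewrite [_ * k]mulrC.
apply: (linext_tensE mF) sn => a.
by rewrite /F /dformS tn_tval.
Qed.

Lemma pi_b n v : pi_fact A n (hoch_b v) = 0.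
Proof.
move: v; apply: (tpow_ext (F := pi_fact A n \o @hoch_b K A n) (G := \0)) => s sn.
transitivity ((n`!%:R : K)^-1 *: (0 : Omega A n)); last exact: scaler0.
rewrite -(dformS_hoch_b sn) scaler_sumr /= /hoch_b linear_sum.
apply: eq_bigr => i _; have lei : (i <= n.+1)%N by rewrite -ltnS.
rewrite linearZZ faceE // pi_factE.
  exact: scaler_swap.
rewrite /faceS; case: leqP => [lein|_]; first exact: size_mulS sn.
by rewrite (size_mulS (leq0n n)) ?size_rotr.
Qed.

Lemma pi_cyc_degen n s : size s = n.+1 ->
  pi_fact A n.+1 (cyc A n.+1 (degen A n (@tensS K A n.+1 s))) =
  ((n.+1)`!%:R : K)^-1 *: ((-1) ^+ n.+1 *: @dwedge K A n.+1 s).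
Proof.
move=> sn; have sn1 : size ((1 : A) :: s) = n.+2 by rewrite /= sn.
rewrite (cyc_degenE sn) linearZZ (pi_factE sn1) (dform_one sn).
exact: scaler_swap.
Qed.

(** After the second rotation the unit is no longer in front, and d1 = 0. *)
Lemma pi_cyc2_degen n v :
  pi_fact A n.+1 (cyc A n.+1 (cyc A n.+1 (degen A n v))) = 0.
Proof.
move: v; apply: (tpow_ext (F := pi_fact A n.+1 \o (cyc A n.+1 \o
  (cyc A n.+1 \o degen A n))) (G := \0)) => s sn /=.
have sn1 : size ((1 : A) :: s) = n.+2 by rewrite /= sn.
have sr1 : size (rotr 1 ((1 : A) :: s)) = n.+2 by rewrite size_rotr.
rewrite (cyc_degenE sn) linearZZ (cycE sn1) !linearZZ (pi_factE sr1).
elim/last_ind: s sn {sn1 sr1} => // s l _; rewrite size_rcons => -[sn].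
rewrite -rcons_cons rotr1_rcons amulE /= ?sn //.
have -> : @dwedge K A n.+1 (1 :: s) = 0.
  have lw := mlin_lin0 (@wedgeS_mlin _ (Omega1 A) n.+1)
    (etrans (size_map (@dOmega K A) s) sn).
  by rewrite /dwedge /= dOmega1; exact: lin0 lw.
by rewrite linear0 !scaler0.
Qed.

(** The sign of the cyclic operator is that of a rotation of n+1 forms. *)
Lemma pi_cyc_degen_cyc n v :
  pi_fact A n.+1 (cyc A n.+1 (degen A n (cyc A n v))) =
  pi_fact A n.+1 (cyc A n.+1 (degen A n v)).
Proof.
pose Q := pi_fact A n.+1 \o (cyc A n.+1 \o degen A n).
move: v; apply: (tpow_ext (F := Q \o cyc A n) (G := Q)) => s sn /=.
have rs : size (rotr 1 s) = n.+1 by rewrite size_rotr.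
rewrite (cycE sn) !linearZZ (pi_cyc_degen rs) (pi_cyc_degen sn) (dwedge_rotr sn).
exact: (@scaler_sign_cancel K (Omega A n.+1)).
Qed.

Hypothesis charK : [pchar K] =i pred0.

Lemma half_exists : exists h : K, h *+ 2 = 1.
Proof.
exists (2%:R)^-1; rewrite -[_ *+ 2]mulr_natr [LHS]mulVf //.
by move/(pcharf0P K): charK => ->.
Qed.

Lemma fact_sign_cancel (V : lmodType K) n m (w : V) :
  (-1) ^+ m *: ((((n.+1)`!%:R : K)^-1 *: ((-1) ^+ m *: w)) *+ n.+1) =
  (n`!%:R : K)^-1 *: w.
Proof.
rewrite scalerMnl scaler_swap scaler_signK; congr (_ *: _).
have n1 : (n.+1%:R : K) != 0 by move/(pcharf0P K): charK => ->.
by rewrite factS natrM invfM -mulr_natl mulrA mulfV // mul1r.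
Qed.

(** In B = (1 - t) t s N the part with the extra t dies, and the n+1 terms of the
    norm N have the same image. *)
Lemma pi_B n v : pi_fact A n.+1 (connes_B v) = deRham A n (pi_fact A n v).
Proof.
have QB w : pi_fact A n.+1 (connes_B w) = (-1) ^+ n.+1 *:
    (pi_fact A n.+1 (cyc A n.+1 (degen A n w)) *+ n.+1).
  rewrite /connes_B linearZZ linearB pi_cyc2_degen subr0; congr (_ *: _).
  rewrite (linear_sum (degen A n)) (linear_sum (cyc A n.+1)).
  rewrite (linear_sum (pi_fact A n.+1)); apply: sum_const_ord => k.
  elim: (k : nat) => //= j IHj.
  by rewrite pi_cyc_degen_cyc.
move: v; apply: (tpow_ext (F := pi_fact A n.+1 \o @connes_B K A n)
  (G := deRham A n \o pi_fact A n)) => s sn.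
rewrite /= QB (pi_cyc_degen sn) (pi_factE sn) [deRham A n _]linearZZ
  (deRhamE half_exists sn).
rewrite (dform_one sn); exact: (@fact_sign_cancel (Omega A n.+1)).
Qed.

End Antisymmetrization.

Section Compatibility.
Variables (K : fieldType) (C : coalgebra K) (A A' : comAlgebra K).
Variable Phi : measuring C A A'.
Hypothesis charK : [pchar K] =i pred0.
Hypothesis cocomC : cocommutative C.

Lemma pi_meas n x v :
  pi_fact A' n (Cn_meas Phi x n v) = Omega_meas Phi x n (pi_fact A n v).
Proof.
move: v; apply: (tpow_ext (F := pi_fact A' n \o Cn_meas Phi x n)
  (G := Omega_meas Phi x n \o pi_fact A n)) => s sn /=.
rewrite (Cn_measE Phi x sn) (pi_factE sn) linearZZ.
rewrite (Omega_measE Phi (half_exists charK) cocomC x sn) linear_swsum.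
rewrite [RHS](linear_swsum ( *:%R (n`!%:R^-1 : K))).
apply: (@eq_swsum K C (Omega A' n)) => t tn.
by rewrite pi_factE // size_measS.
Qed.

Lemma Omega_meas_d n x w :
  Omega_meas Phi x n.+1 (deRham A n w) = deRham A' n (Omega_meas Phi x n w).
Proof.
have half := half_exists charK.
move: w; apply: (Omega_ext (F := Omega_meas Phi x n.+1 \o deRham A n)
  (G := deRham A' n \o Omega_meas Phi x n)) => s sn /=.
have sn1 : size ((1 : A) :: s) = n.+2 by rewrite /= sn.
rewrite (deRhamE half sn) (Omega_measE Phi half cocomC x sn1).
rewrite (Omega_measE Phi half cocomC x sn) linear_swsum.
rewrite (swsum_meas_one Phi x s (@dformS_mlin K A' n.+1)).
apply: (@eq_swsum K C (Omega A' n.+1)) => t tn; rewrite (deRhamE half) //.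
by rewrite size_measS.
Qed.

Lemma Omega_meas_in n x u :
  exists u', Omega_meas Phi x n (deRham_in A n u) = deRham_in A' n u'.
Proof.
case: n u => [|n] u; first by exists 0; rewrite !linear0.
by exists (Omega_meas Phi x n u); exact: Omega_meas_d.
Qed.

Lemma Omega_coker_measE n x v :
  Omega_coker_meas Phi x n (cclass (deRham_in A n) v) =
  cclass (deRham_in A' n) (Omega_meas Phi x n v).
Proof.
apply: cmapE; first exact: linearP.
exact: Omega_meas_in.
Qed.

Lemma HDR_measE n x v : deRham A n v = 0 ->
  HDR_meas Phi x n (hclass (deRham_in A n) (deRham A n) v) =
  hclass (deRham_in A' n) (deRham A' n) (Omega_meas Phi x n v).
Proof.
apply: hmapE; [exact: linearP| |exact: Omega_meas_in] => u du.
by rewrite -Omega_meas_d du linear0.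
Qed.

Lemma dsum_HDR_measE n x (w : dsum (Omega A) n) : dclosed w ->
  dsum_map (HDR_meas Phi x)
    (dsum_map (fun p => hclass (deRham_in A p) (deRham A p)) w) =
  dsum_map (fun p => hclass (deRham_in A' p) (deRham A' p))
    (dsum_map (Omega_meas Phi x) w).
Proof.
move: w; suff [] : (forall w : dsum (Omega A) n, dclosed w ->
    dsum_map (HDR_meas Phi x)
      (dsum_map (fun p => hclass (deRham_in A p) (deRham A p)) w) =
    dsum_map (fun p => hclass (deRham_in A' p) (deRham A' p))
      (dsum_map (Omega_meas Phi x) w)) /\
  (forall w : dsum (Omega A) n.+1, dclosed w ->
    dsum_map (HDR_meas Phi x)
      (dsum_map (fun p => hclass (deRham_in A p) (deRham A p)) w) =
    dsum_map (fun p => hclass (deRham_in A' p) (deRham A' p))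
      (dsum_map (Omega_meas Phi x) w)) by [].
elim: n => [|n [IHn IHn1]]; first by split=> w; exact: HDR_measE.
split=> // -[w1 w2] [dw1 dw2]; apply: (congr2 pair); first exact: HDR_measE.
exact: IHn.
Qed.

Lemma Omega_classes_meas n x (w : dsum (Omega A) n) :
  @tot_diff K (Omega_mixed A) n w = 0 ->
  deRham_sum_meas Phi x (Omega_classes w) =
  Omega_classes (dsum_map (Omega_meas Phi x) w).
Proof.
case: n w => [|[|n]] w; try by move=> _; exact: Omega_coker_measE.
move=> /cycle_dclosed dw; apply: (congr2 pair); first exact: Omega_coker_measE.
exact: dsum_HDR_measE.
Qed.

End Compatibility.

Lemma dsum_map_comp (K : pzRingType) (U V W : nat -> lmodType K)
    (h : forall p, U p -> V p) (k : forall p, V p -> W p) n (u : dsum U n) :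
  dsum_map k (dsum_map h u) = dsum_map (fun p => k p \o h p) u.
Proof.
move: u; suff [] : (forall u : dsum U n,
    dsum_map k (dsum_map h u) = dsum_map (fun p => k p \o h p) u) /\
  (forall u : dsum U n.+1,
    dsum_map k (dsum_map h u) = dsum_map (fun p => k p \o h p) u) by [].
elim: n => [|n [IHn IHn1]]; first by split.
by split=> // -[u1 u2]; apply: (congr2 pair); last exact: IHn.
Qed.

Lemma pibarE (K : fieldType) (charK : [pchar K] =i pred0) (A : comAlgebra K) n
    (z : dsum (Cn A) n) : @tot_diff K (cyclic_mixed A) n z = 0 ->
  pibar (hclass (@tot_diff K (cyclic_mixed A) n.+1)
    (@tot_diff K (cyclic_mixed A) n) z) =
  Omega_classes (dsum_map (pi_fact A) z) /\
  @tot_diff K (Omega_mixed A) n (dsum_map (pi_fact A) z) = 0.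
Proof.
move=> z0.
have lh p : linear (pi_fact A p) by exact: linearP.
have hb m v : pi_fact A m (mb (cyclic_mixed A) m v) =
    mb (Omega_mixed A) m (pi_fact A m.+1 v) by exact: pi_b.
have hB m v : pi_fact A m.+1 (mB (cyclic_mixed A) m v) =
    mB (Omega_mixed A) m (pi_fact A m v) by exact: pi_B charK _ _.
have w0 : @tot_diff K (Omega_mixed A) n (dsum_map (pi_fact A) z) = 0.
  rewrite -(@dsum_map_diff K (cyclic_mixed A) (Omega_mixed A)
    (fun p => pi_fact A p) lh hb hB n z) z0.
  exact: (lin0 (@dsum_map_linear K _ _ (fun p => pi_fact A p) n.-1 lh)).
split=> //; rewrite /pibar.
by rewrite (@tot_hmapE K (cyclic_mixed A) (Omega_mixed A)
    (fun p => pi_fact A p) lh hb hB n z z0) Omega_splitE.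
Qed.

Theorem proposition2p6 (K : fieldType) (charK : [pchar K] =i pred0)
    (A A' : comAlgebra K) (C : coalgebra K) (cocomC : cocommutative C)
    (Phi : measuring C A A') (x : C) (n : nat) (h : HC A n) :
  deRham_sum_meas Phi x (pibar h) = pibar (HC_meas Phi x n h).
Proof.
have [z z0 ->] := hclass_surj h.
have lh p : linear (Cn_meas Phi x p) by exact: linearP.
have hb m v : Cn_meas Phi x m (mb (cyclic_mixed A) m v) =
    mb (cyclic_mixed A') m (Cn_meas Phi x m.+1 v) by exact: Cn_meas_b.
have hB m v : Cn_meas Phi x m.+1 (mB (cyclic_mixed A) m v) =
    mB (cyclic_mixed A') m (Cn_meas Phi x m v) by exact: Cn_meas_B.
rewrite /HC_meas (@tot_hmapE K (cyclic_mixed A) (cyclic_mixed A')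
  (fun p => Cn_meas Phi x p) lh hb hB n z z0).
have z'0 : @tot_diff K (cyclic_mixed A') n (dsum_map (Cn_meas Phi x) z) = 0.
  rewrite -(@dsum_map_diff K (cyclic_mixed A) (cyclic_mixed A')
  (fun p => Cn_meas Phi x p) lh hb hB n z) z0.
  exact: (lin0 (@dsum_map_linear K _ _ (fun p => Cn_meas Phi x p) n.-1 lh)).
have [-> w0] := pibarE charK z0; have [-> _] := pibarE charK z'0.
rewrite Omega_classes_meas // !dsum_map_comp; congr Omega_classes.
congr (dsum_map _ z); apply: functional_extensionality_dep => p.
by apply: funext => v; rewrite /= pi_meas.
Qed.
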